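(* Let $\varepsilon\in(0,1)$, $d\ge 1$, and let $\{A_g\}_{g\in\mathbb{F}_q^n}$ be subsets of $\mathbb{F}_q^n$ with $\sum_g|A_g|\ge2^{-d}q^{2n}$. Let $F=\sum_g1_{A_g}\circ1_{A_g+g}$, $F'=\sum_g1_{A_g}\circ1_{A_g}$, and $D(x)=|A_x|$. Then either (1) $|\langle\mu_F,\mu_D\rangle-1|\le\varepsilon$, or (2) there is a subspace $V$ of co-dimension at most $C_\varepsilon d^8$ such that $\|\mu_{F'}*\mu_V\|_\infty\ge1+\varepsilon/32$, where $C_\varepsilon$ depends only on $\varepsilon$.
   Context: Averages are normalized over $\mathbb{F}_q^n$: $\langle f,g\rangle=\mathbb{E}_xf(x)g(x)$, $(f\circ g)(x)=\mathbb{E}_yf(y)g(x+y)$, $(f*g)(x)=\mathbb{E}_yf(y)g(x-y)$. For $f$ with $\mathbb{E}f\neq0$, $\mu_f=f/\mathbb{E}[f]$; $\mu_V=\frac{q^n}{|V|}1_V$. *)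

(* Defs.v *)
From HB Require Import structures.
From mathcomp Require Import all_boot all_order all_algebra all_field.
From mathcomp Require Import all_classical all_reals all_analysis.
Set Implicit Arguments. Unset Strict Implicit. Unset Printing Implicit Defensive.
Import Order.TTheory GRing.Theory Num.Theory.
Local Open Scope ring_scope.

Section Defs.
Variables (R : realType) (K : finFieldType) (n : nat).
Notation V := 'rV[K]_n.

Definition avg (f : V -> R) : R := (\sum_x f x) / #|{: V}|%:R.
Definition inner (f g : V -> R) : R := avg (fun x => f x * g x).
Definition corr (f g : V -> R) : V -> R := fun x => avg (fun y => f y * g (x + y)).
Definition convol (f g : V -> R) : V -> R := fun x => avg (fun y => f y * g (x - y)).
Definition ind (A : {set V}) : V -> R := fun x => (x \in A)%:R.
Definition mu_of (f : V -> R) : V -> R := fun x => f x / avg f.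
Definition mu_sub (W : {vspace V}) : V -> R :=
  fun x => (#|{: V}|%:R / #|[set y : V | y \in W]|%:R) * (x \in W)%:R.
Definition supnorm (f : V -> R) : R := \big[Num.max/0]_(x : V) `|f x|.
Definition translate (A : {set V}) (g : V) : {set V} := [set a + g | a in A].
End Defs.

(* Main.v *)
Require Import Defs.
From HB Require Import structures.
From mathcomp Require Import all_boot all_order all_algebra all_field.
From mathcomp Require Import all_classical all_reals all_analysis.
From mathcomp Require Import ring lra.
Import Order.TTheory GRing.Theory Num.Theory.
Local Open Scope ring_scope.
Set Implicit Arguments. Unset Strict Implicit. Unset Printing Implicit Defensive.

(* Suppose that (1) fails. Weighted power means against [D], which is bounded and
   has density at least [2 ^ -d], make an even moment of order [O(d)] of
   [mu_F - 1] at least about [eps ^ p]. The function [mu_F - 1] is a sum of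
   translates of autocorrelations, and [mu_F' - 1] is the same sum untranslated,
   so the moments of the latter dominate and are nonnegative. Keeping one term of
   the binomial expansion of [(1 + (mu_F' - 1)) ^ P] with [P = O(d)] then shows
   that [mu_F' ^ P] is concentrated on [S = {mu_F' >= 1 + eps / 8}]. Intersecting
   [P] random translates of random [A_g] gives a set [B] of density
   [exp (- O(d ^ 2))] with almost all differences in [S].

   The function [1_S * 1_B * 1_{-B}] is almost invariant under a subspace: random
   sampling from [B] and exponential tail bounds (Croot-Sisask) give a set [T] of
   almost periods of density [exp (- O(d ^ 8))]; smoothing repeatedly by [T - T]
   damps every frequency outside the large spectrum of [T], and by Chang's
   argument that spectrum vanishes on a subspace of codimension [O(d ^ 8)].
   Some coset of it therefore meets [S] in proportion close to [1]. *)

(** * Elementary inequalities *)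

Section Elementary.
Variable R : realType.

(** Multiply by the positive factor [1 - x]: the left side becomes at most [1], while the right side
    becomes [1 + x ^+ 2 * (1 - 2 * x)]. *)
Lemma expR_le_quadratic (x : R) : x <= 1 / 2 -> expR x <= 1 + x + 2 * x ^+ 2.
Proof.
move=> hx.
have h := expR_ge1Dx (- x).
rewrite expRN in h.
have e0 := expR_gt0 x.
have : (1 - x) * expR x <= 1.
  by rewrite -ler_pdivlMr // mul1r.
move=> h1.
have : 1 <= (1 - x) * (1 + x + 2 * x ^+ 2).
  have : 0 <= x ^+ 2 * (1 - 2 * x) by apply: mulr_ge0; [exact: sqr_ge0 | lra].
  lra.
move=> h2.
have h3 : (1 - x) * expR x <= (1 - x) * (1 + x + 2 * x ^+ 2) by apply: le_trans h1 h2.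
by rewrite ler_pM2l in h3; [| lra].
Qed.

(** Convexity of the power: multiplying the induction hypothesis by [a] leaves the excess
    [p.+1%:R * b ^+ p * (a - b) ^+ 2]. For [b = 1] this is Bernoulli's inequality. *)
Lemma exprn_ge_tangent p (a b : R) : 0 <= a -> 0 <= b ->
  b ^+ p.+1 + p.+1%:R * b ^+ p * (a - b) <= a ^+ p.+1.
Proof.
move=> a0 b0; elim: p => [|p IH]; first by rewrite !expr1 expr0; lra.
have hb : 0 <= p.+1%:R * b ^+ p * (a - b) ^+ 2.
  by apply: mulr_ge0; [apply: mulr_ge0 => //; exact: exprn_ge0 | exact: sqr_ge0].
have := ler_wpM2l a0 IH; rewrite -exprS => h.
apply: le_trans h; rewrite -subr_ge0; apply: le_trans hb _.
rewrite le_eqVlt; apply/orP; left; apply/eqP.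
rewrite -[p.+2%:R]natr1 [b ^+ p.+2]exprS [b ^+ p.+1]exprS.
move: (p.+1%:R) (b ^+ p) (a ^+ p.+1) => c B D; ring.
Qed.

(** Jensen's inequality: average the tangent bound at the mean [b], where the linear term
    cancels. *)
Lemma power_mean (T : finType) (w f : T -> R) p :
  (forall x, 0 <= w x) -> (forall x, 0 <= f x) -> \sum_x w x = 1 ->
  (\sum_x w x * f x) ^+ p.+1 <= \sum_x w x * f x ^+ p.+1.
Proof.
move=> w0 f0 w1; set b := \sum_x w x * f x.
have b0 : 0 <= b by apply: sumr_ge0 => x _; exact: mulr_ge0.
have -> : b ^+ p.+1 = \sum_x w x * (b ^+ p.+1 + p.+1%:R * b ^+ p * (f x - b)).
  rewrite (eq_bigr (fun x => w x * b ^+ p.+1 + (p.+1%:R * b ^+ p) * (w x * f x - w x * b))); last first.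
    by move=> x _; rewrite mulrDr; congr (_ + _); rewrite mulrCA mulrBr.
  rewrite big_split /= -mulr_suml w1 -mulr_sumr big_split /= sumrN -mulr_suml w1.
  by rewrite -/b mul1r mul1r subrr mulr0 addr0.
by apply: ler_sum => x _; apply: ler_wpM2l => //; exact: exprn_ge_tangent.
Qed.

Lemma ex_le_of_sum_le (T : finType) (f : T -> R) (c : R) :
  (0 < #|T|)%N -> c * #|T|%:R <= \sum_x f x -> exists x, c <= f x.
Proof.
move=> T0 h; apply/not_existsP => H.
have {}H x : f x < c by rewrite ltNge; apply/negP; exact: H.
suff : \sum_x f x < \sum_(x : T) c by rewrite sumr_const -mulr_natr ltNge h.
apply: ltr_sum => [|x _ //]; have /card_gt0P[x _] := T0.
by apply/hasP; exists x; rewrite ?mem_index_enum.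
Qed.

(** The quadratic bound applies termwise and its linear term sums to zero. Both the sampling tail
    and Chang's theorem rest on this estimate. *)
Lemma mgf_le (T : finType) (A : {set T}) (X : T -> R) (c : R) :
  `|c| <= 1 / 2 -> (forall t, t \in A -> `|X t| <= 1) -> \sum_(t in A) X t = 0 ->
  \sum_(t in A) expR (c * X t) <= #|A|%:R * expR (2 * c ^+ 2).
Proof.
move=> hc hX X0.
apply: (@le_trans _ _ (\sum_(t in A) (expR (2 * c ^+ 2) + c * X t))).
  apply: ler_sum => t At; have h1 := hX t At.
  have hcX : `|c * X t| <= 1 / 2.
    by rewrite normrM -[1 / 2]mulr1; apply: ler_pM.
  apply: le_trans (expR_le_quadratic _ ) _.
    by apply: le_trans hcX; exact: ler_norm.
  have h2 := expR_ge1Dx (2 * c ^+ 2).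
  have : (c * X t) ^+ 2 <= c ^+ 2.
    rewrite exprMn ler_piMr ?sqr_ge0 // -real_normK ?num_real //.
    by rewrite exprn_ile1.
  lra.
by rewrite big_split /= -mulr_sumr X0 mulr0 addr0 sumr_const -[leLHS]mulr_natl.
Qed.

(** Every term of the binomial expansion is non-negative after summation, odd powers included, so
    any single term is a lower bound. *)
Lemma sum_expn_ge0_binomial (T : finType) (f : T -> R) n p :
  (forall j, 0 <= \sum_x f x ^+ j) -> (p <= n)%N ->
  'C(n, p)%:R * (\sum_x f x ^+ p) <= \sum_x (1 + f x) ^+ n.
Proof.
move=> f0 pn.
have -> : \sum_x (1 + f x) ^+ n = \sum_(i < n.+1) 'C(n, i)%:R * \sum_x f x ^+ i.
  rewrite (eq_bigr (fun x => \sum_(i < n.+1) 'C(n, i)%:R * f x ^+ i)); last first.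
    by move=> x _; rewrite exprDn; apply: eq_bigr => i _; rewrite expr1n mul1r mulr_natl.
  by rewrite exchange_big /=; apply: eq_bigr => i _; rewrite mulr_sumr.
have pn' : (p < n.+1)%N by rewrite ltnS.
rewrite (bigD1 (Ordinal pn')) //= lerDl.
by apply: sumr_ge0 => i _; rewrite mulr_ge0.
Qed.

End Elementary.

(** Factor by factor: [M * (k - i) <= n - i] follows from [M * k <= n] and [1 <= M]. *)
Lemma ffact_mul_le M p k n : (0 < M)%N -> (M * k <= n)%N ->
  (M ^ p * k ^_ p <= n ^_ p)%N.
Proof.
move=> M0; elim: p k n => [|p IH] k n h; first by rewrite !ffactn0.
case: k h => [|k] h; first by rewrite ffact0n /= muln0.
case: n h => [|n] h; first by move: h; rewrite leqn0 muln_eq0 /= -leqn0 leqNgt M0.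
rewrite !ffactSS expnS mulnACA leq_mul //; apply: IH.
rewrite -ltnS; apply: leq_trans h.
by rewrite mulnS -add1n leq_add2r.
Qed.

Lemma expn_le_bin M p : (0 < M)%N -> (M ^ p <= 'C(M * p, p))%N.
Proof.
move=> M0; rewrite -(leq_pmul2r (fact_gt0 p)) bin_ffact -ffactnn.
exact: ffact_mul_le.
Qed.

(** * Moments of autocorrelations *)

Section Moments.
Variables (R : realType) (G : finZmodType).

Definition autocorr (b : G -> R) (x : G) : R := \sum_y b y * b (x + y).

Section Diagonal.
Variables (p : nat) (H : {ffun 'I_p -> G} -> R).
Let dg (x : G) : {ffun 'I_p -> G} := [ffun=> x].

(** Up to the factor [#|G|], both sides are inner products of the diagonal sums [J]: of [J] with its
    translate by [s] on the left, of [J] with itself on the right. Cauchy-Schwarz compares them. *)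
Lemma diag_correlation_le (s : {ffun 'I_p -> G}) :
  `|\sum_x \sum_y H y * H (y + dg x - s)| <= \sum_x \sum_y H y * H (y + dg x).
Proof.
pose J (y : {ffun 'I_p -> G}) := \sum_z H (y + dg z).
have dgD x z : dg (x + z) = dg x + dg z by apply/ffunP => i; rewrite !ffunE.
have JE (t : {ffun 'I_p -> G}) : \sum_y J y * J (y - t) =
    #|G|%:R * \sum_x \sum_y H y * H (y + dg x - t).
  transitivity (\sum_(z : G) \sum_x \sum_y H y * H (y + dg x - t)); last first.
    by rewrite sumr_const mulr_natl.
  transitivity (\sum_(y : {ffun 'I_p -> G}) \sum_(z : G) \sum_x H (y + dg z) * H (y + dg z + dg x - t)).
    apply: eq_bigr => y _; rewrite /J mulr_suml; apply: eq_bigr => z _.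
    rewrite mulr_sumr (reindex_inj (addIr z)); apply: eq_bigr => x _.
    by rewrite dgD [dg x + _]addrC addrAC !addrA.
  rewrite exchange_big /=; apply: eq_bigr => z _.
  rewrite exchange_big /=; apply: eq_bigr => x _.
  by rewrite [RHS](reindex_inj (addIr (dg z))).
have N0 : 0 < #|G|%:R :> R by rewrite ltr0n; apply/card_gt0P; exists 0.
have := JE 0; under eq_bigr => y _ do rewrite subr0.
under [in RHS]eq_bigr => x _ do under eq_bigr => y _ do rewrite subr0.
move=> J0.
rewrite -(ler_pM2l N0) -J0 -(gtr0_norm N0) -normrM -JE.
apply: le_trans (ler_norm_sum _ _ _) _.
(* Cauchy-Schwarz in arithmetic-geometric form; translation invariance makes the two sums of squares
   equal. *)
apply: (@le_trans _ _ (\sum_(y : {ffun 'I_p -> G}) (J y ^+ 2 + J (y - s) ^+ 2) / 2)).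
  apply: ler_sum => y _; rewrite ler_norml.
  have := sqr_ge0 (J y - J (y - s)); have := sqr_ge0 (J y + J (y - s)).
  by move=> h1 h2; apply/andP; split; lra.
rewrite -mulr_suml big_split /= [X in _ + X](_ : _ = \sum_y J y ^+ 2); last first.
  by rewrite [RHS](reindex_inj (addIr (- s))).
under [leRHS]eq_bigr => y _ do rewrite -expr2.
lra.
Qed.

End Diagonal.

(* Expanding the [p]-th power turns each moment into a sum of correlations on
   [G ^ p] along the diagonal, to which Cauchy-Schwarz applies. *)
Lemma moment_shift_le (I : finType) (b : I -> G -> R) (sh : I -> G) p :
  `|\sum_x (\sum_i autocorr (b i) (x - sh i)) ^+ p| <=
  \sum_x (\sum_i autocorr (b i) x) ^+ p.
Proof.
pose H (u : {ffun 'I_p -> I}) (y : {ffun 'I_p -> G}) := \prod_j b (u j) (y j).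
pose dg (x : G) : {ffun 'I_p -> G} := [ffun=> x].
(* Expanding the power, [u] selects the index and [y] the base point of the autocorrelation in each
   of the [p] factors. *)
have E (t : I -> G) x : (\sum_i autocorr (b i) (x - t i)) ^+ p =
    \sum_u \sum_y H u y * H u (y + dg x - [ffun j => t (u j)]).
  rewrite -[in LHS](card_ord p) -prodr_const bigA_distr_bigA /=.
  apply: eq_bigr => u _; rewrite bigA_distr_bigA /=; apply: eq_bigr => y _.
  rewrite /H -big_split /=; apply: eq_bigr => j _; rewrite !ffunE.
  by congr (_ * b _ _); rewrite [LHS]addrC addrA.
have E0 x : (\sum_i autocorr (b i) x) ^+ p = \sum_u \sum_y H u y * H u (y + dg x).
  have := E (fun=> 0) x; under eq_bigr => i _ do rewrite subr0.
  move=> ->; apply: eq_bigr => u _; apply: eq_bigr => y _.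
  by congr (_ * H u _); apply/ffunP => j; rewrite !ffunE subr0.
under eq_bigr => x _ do rewrite E.
under [leRHS]eq_bigr => x _ do rewrite E0.
rewrite exchange_big /= [leRHS]exchange_big /=.
apply: le_trans (ler_norm_sum _ _ _) _; apply: ler_sum => u _.
exact: diag_correlation_le.
Qed.

Lemma moment_ge0 (I : finType) (b : I -> G -> R) p :
  0 <= \sum_x (\sum_i autocorr (b i) x) ^+ p.
Proof. by apply: le_trans (moment_shift_le b (fun=> 0) p). Qed.

End Moments.

(** * Sifting *)

Section Sifting.
Variables (R : realType) (G : finZmodType) (A : G -> {set G}).

(** Up to the factor [#|G|], this is the function [F'] of the theorem. *)
Definition diffcount (x : G) : R :=
  \sum_g \sum_y (y \in A g)%:R * (x + y \in A g)%:R.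

(** The intersection of the [P] translates [A g + h], with [(g, h)] running over the values of
    [u]. *)
Definition sift P (u : {ffun 'I_P -> G * G}) : {set G} :=
  [set y | [forall i, y - (u i).2 \in A (u i).1]].

Lemma natr_forall (I : finType) (Q : pred I) :
  [forall i, Q i]%:R = \prod_i (Q i)%:R :> R.
Proof.
have [/forallP h|] := boolP [forall i, Q i].
  by rewrite big1 // => i _; rewrite h.
rewrite negb_forall => /existsP[i ni].
by rewrite (bigD1 i) //= (negbTE ni) mul0r.
Qed.

(** For fixed [a] and [x], the condition that [a] and [x + a] both lie in [sift u] factors over the
    coordinates of [u], and each coordinate sums to [diffcount x]. *)
Lemma sum_sift_pairs P (w : G -> R) :
  \sum_(u : {ffun 'I_P -> G * G}) \sum_(a in sift u) \sum_(b in sift u) w (b - a) =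
  #|G|%:R * \sum_x w x * diffcount x ^+ P.
Proof.
have S (u : {ffun 'I_P -> G * G}) :
    \sum_(a in sift u) \sum_(b in sift u) w (b - a) =
    \sum_a \sum_x w x * ((a \in sift u)%:R * (x + a \in sift u)%:R).
  rewrite big_mkcond /=; apply: eq_bigr => a _.
  case: ifP => _; last by rewrite big1 // => x _; rewrite mul0r mulr0.
  rewrite big_mkcond /= (reindex_inj (addIr a)); apply: eq_bigr => x _.
  by rewrite addrK mul1r; case: ifP; rewrite ?mulr1 ?mulr0.
under eq_bigr => u _ do rewrite S.
rewrite exchange_big /=.
under eq_bigr => a _ do rewrite exchange_big /=.
transitivity (\sum_(a : G) \sum_x w x * diffcount x ^+ P); last first.
  by rewrite sumr_const mulr_natl.
apply: eq_bigr => a _; apply: eq_bigr => x _.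
rewrite -mulr_sumr; congr (_ * _).
transitivity (\sum_(u : {ffun 'I_P -> G * G}) \prod_i
   ((a - (u i).2 \in A (u i).1)%:R * (x + a - (u i).2 \in A (u i).1)%:R) : R).
  by apply: eq_bigr => u _; rewrite !inE !natr_forall big_split.
rewrite -(bigA_distr_bigA (fun (_ : 'I_P) (v : G * G) =>
   (a - v.2 \in A v.1)%:R * (x + a - v.2 \in A v.1)%:R)) prodr_const card_ord.
congr (_ ^+ _); rewrite /diffcount pair_bigA /=.
rewrite (reindex (fun v : G * G => (v.1, a - v.2))) /=.
  by apply: eq_bigr => v _; rewrite -[x + a - _]addrA !subKr.
exists (fun v : G * G => (v.1, a - v.2)) => -[g y] _ /=; by rewrite subKr.
Qed.

Lemma exists_sift P (S : {set G}) (th : R) : 0 < th ->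
  \sum_(x in ~: S) diffcount x ^+ P <= th * \sum_x diffcount x ^+ P ->
  0 < \sum_x diffcount x ^+ P ->
  exists B : {set G},
    \sum_x diffcount x ^+ P <= 2 * #|G|%:R ^+ (2 * P) / #|G|%:R * #|B|%:R ^+ 2 /\
    \sum_(a in B) \sum_(b in B) (b - a \notin S)%:R <= 2 * th * #|B|%:R ^+ 2.
Proof.
move=> th0 hS S0.
have N0 : 0 < #|G|%:R :> R by rewrite ltr0n; apply/card_gt0P; exists 0.
(* This weight merges both requirements into one average. A [u] attaining the average has a positive
   weighted count, which bounds the bad pairs, and dropping the penalty bounds the size of the set
   from below. *)
pose w (x : G) : R := 1 - (x \notin S)%:R / (2 * th).
have [||u hu] := @ex_le_of_sum_le R {ffun 'I_P -> G * G}
  (fun u => \sum_(a in sift u) \sum_(b in sift u) w (b - a))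
  (#|G|%:R / 2 * (\sum_x diffcount x ^+ P) / #|G|%:R ^+ (2 * P)).
- by apply/card_gt0P; exists [ffun=> (0, 0)].
- rewrite sum_sift_pairs card_ffun card_ord card_prod natrX natrM -expr2 -exprM.
  rewrite mulfVK; last by rewrite expf_neq0 // gt_eqF.
  rewrite -mulrA ler_pM2l //.
  have -> : \sum_x w x * diffcount x ^+ P = \sum_x diffcount x ^+ P -
      (\sum_(x in ~: S) diffcount x ^+ P) / (2 * th).
    rewrite [X in _ - X / _]big_mkcond /= mulr_suml -sumrB; apply: eq_bigr => x _.
    rewrite /w inE; case: ifP => _; by rewrite ?mul0r ?subr0 ?mul1r // mulrBl mul1r mulrC.
  have : (\sum_(x in ~: S) diffcount x ^+ P) / (2 * th) <=
         (\sum_x diffcount x ^+ P) / 2.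
    rewrite ler_pdivrMr ?mulr_gt0 //; apply: le_trans hS _.
    by rewrite le_eqVlt; apply/orP; left; apply/eqP; field.
  lra.
exists (sift u).
have E : \sum_(a in sift u) \sum_(b in sift u) w (b - a) = #|sift u|%:R ^+ 2 -
    (\sum_(a in sift u) \sum_(b in sift u) (b - a \notin S)%:R) / (2 * th).
  rewrite mulr_suml expr2 mulr_natl -sumr_const -sumrB; apply: eq_bigr => a _.
  by rewrite mulr_suml -sumr_const -sumrB.
rewrite E in hu.
have c0 : 0 < #|G|%:R / 2 * (\sum_x diffcount x ^+ P) / #|G|%:R ^+ (2 * P).
  by rewrite !divr_gt0 ?mulr_gt0 ?exprn_gt0 ?invr_gt0.
have b0 : 0 <= (\sum_(a in sift u) \sum_(b in sift u) (b - a \notin S)%:R) / (2 * th).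
  apply: divr_ge0; last by rewrite mulr_ge0 // ltW.
  by apply: sumr_ge0 => a _; apply: sumr_ge0.
split.
  have h : #|G|%:R / 2 * (\sum_x diffcount x ^+ P) / #|G|%:R ^+ (2 * P) <= #|sift u|%:R ^+ 2 by lra.
  rewrite ler_pdivrMr ?exprn_gt0 // in h.
  rewrite -(ler_pM2l N0); apply: (@le_trans _ _ (2 * (#|G|%:R / 2 * \sum_x diffcount x ^+ P))); first lra.
  apply: (@le_trans _ _ (2 * (#|sift u|%:R ^+ 2 * #|G|%:R ^+ (2 * P)))); first by rewrite ler_pM2l.
  rewrite le_eqVlt; apply/orP; left; apply/eqP; field; by rewrite gt_eqF.
have : (\sum_(a in sift u) \sum_(b in sift u) (b - a \notin S)%:R) / (2 * th) <= #|sift u|%:R ^+ 2 by lra.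
by rewrite ler_pdivrMr ?mulr_gt0 // [X in _ <= X]mulrC.
Qed.

End Sifting.

(** * Almost periods by random sampling *)

Lemma natr_card_setIdE (R : realType) (T : finType) (A : {set T}) (Q : pred T) :
  #|[set u in A | Q u]|%:R = \sum_(u in A) (Q u)%:R :> R.
Proof.
rewrite -sum1_card natr_sum big_mkcond [RHS]big_mkcond /=; apply: eq_bigr => u _.
by rewrite inE; case: (u \in A) => //=; case: (Q u).
Qed.

Lemma natr_card_setE (R : realType) (T : finType) (Q : pred T) :
  #|[set u | Q u]|%:R = \sum_u (Q u)%:R :> R.
Proof.
rewrite -sum1_card natr_sum big_mkcond /=; apply: eq_bigr => u _.
by rewrite inE; case: (Q u).
Qed.

Section Sampling.
Variables (R : realType) (T : finType) (A : {set T}) (l : nat).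

Definition samples : {set {ffun 'I_l -> T}} := [set u : {ffun 'I_l -> T} | [forall i, u i \in A]].

Lemma sum_samples_prod (F : T -> R) :
  \sum_(u in samples) \prod_i F (u i) = (\sum_(a in A) F a) ^+ l.
Proof.
rewrite -[in RHS](card_ord l) -prodr_const.
rewrite (bigA_distr_big (fun a => a \in A) (fun _ a => F a)).
by apply: eq_bigl => u; rewrite inE; apply/forallP/ffun_onP.
Qed.

Lemma card_samples : #|samples|%:R = #|A|%:R ^+ l :> R.
Proof.
rewrite -[#|A|%:R]sumr_const -sum_samples_prod -sum1_card natr_sum.
by apply: eq_bigr => u _; rewrite big1.
Qed.

(** Markov's inequality for the exponential moment. The parameter [dl / 4] minimises
    [2 * c ^+ 2 - c * dl], with minimum [- dl ^+ 2 / 8]. *)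
Lemma sampling_tail (X : T -> R) (dl : R) : 0 <= dl -> dl <= 1 ->
  (forall a, a \in A -> `|X a| <= 1) -> \sum_(a in A) X a = 0 ->
  #|[set u in samples | dl * l%:R < \sum_i X (u i)]|%:R <=
  #|A|%:R ^+ l * expR (- (dl ^+ 2 * l%:R / 8)).
Proof.
move=> dl0 dl1 hX X0; set E := [set u in _ | _].
have hm := @mgf_le R T A X (dl / 4) _ hX X0.
have {}hm : \sum_(a in A) expR (dl / 4 * X a) <= #|A|%:R * expR (2 * (dl / 4) ^+ 2).
  by apply: hm; rewrite ger0_norm; lra.
have h : \sum_(u in samples) expR (dl / 4 * \sum_i X (u i)) <=
    #|A|%:R ^+ l * expR (2 * (dl / 4) ^+ 2 * l%:R).
  rewrite [_ * l%:R]mulrC expRM_natl -exprMn.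
  rewrite (eq_bigr (fun u : {ffun _} => \prod_i expR (dl / 4 * X (u i)))); last first.
    by move=> u _; rewrite mulr_sumr expR_sum.
  rewrite (sum_samples_prod (fun a => expR (dl / 4 * X a))).
  apply: lerXn2r => //; rewrite nnegrE.
    by apply: sumr_ge0 => a _; exact: expR_ge0.
  by rewrite mulr_ge0 ?expR_ge0.
have h2 : #|E|%:R * expR (dl / 4 * (dl * l%:R)) <=
    \sum_(u in samples) expR (dl / 4 * \sum_i X (u i)).
  rewrite mulr_natl -sumr_const big_mkcond [leRHS]big_mkcond /=.
  apply: ler_sum => u _; rewrite inE; case: ifP => [/andP[-> hu]|_].
    by rewrite ler_expR; apply: ler_wpM2l; [lra | exact: ltW].
  by case: ifP => // _; exact: expR_ge0.
rewrite -(ler_pM2r (expR_gt0 (dl / 4 * (dl * l%:R)))).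
apply: le_trans h2 _; apply: le_trans h _.
rewrite -[leRHS]mulrA -expRD; apply: ler_wpM2l; first by rewrite exprn_ge0.
by rewrite ler_expR le_eqVlt; apply/orP; left; apply/eqP; field.
Qed.

End Sampling.

Section AlmostPeriods.
Variables (R : realType) (G : finZmodType) (B : {set G}) (f : G -> R).
Hypotheses (B0 : (0 < #|B|)%N) (f01 : forall x, 0 <= f x <= 1).

(** The convolution of [f] with the uniform probability measure on [B]; [empirical] below is its
    estimate from [l] sampled points. *)
Definition smooth (y : G) : R := (\sum_(b in B) f (y - b)) / #|B|%:R.

Lemma smooth01 y : 0 <= smooth y <= 1.
Proof.
have b0 : 0 < #|B|%:R :> R by rewrite ltr0n.
rewrite /smooth divr_ge0 /=; last by rewrite ltW.
  rewrite ler_pdivrMr // mul1r -sumr_const.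
  by apply: ler_sum => b _; case/andP: (f01 (y - b)).
by apply: sumr_ge0 => b _; case/andP: (f01 (y - b)).
Qed.

Section Empirical.
Variable l : nat.
Hypothesis l0 : (0 < l)%N.

Definition empirical (u : {ffun 'I_l -> G}) (y : G) : R := (\sum_i f (y - u i)) / l%:R.

Lemma empirical01 u y : 0 <= empirical u y <= 1.
Proof.
have l0' : 0 < l%:R :> R by rewrite ltr0n.
rewrite /empirical divr_ge0 /=; last by rewrite ltW.
  rewrite ler_pdivrMr // mul1r -[l in leRHS]card_ord -sumr_const.
  by apply: ler_sum => b _; case/andP: (f01 (y - u b)).
by apply: sumr_ge0 => b _; case/andP: (f01 (y - u b)).
Qed.

Lemma empirical_tail (dl : R) y : 0 <= dl -> dl <= 1 ->
  #|[set u in samples B l | dl < `|smooth y - empirical u y|]|%:R <=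
  2 * expR (- (dl ^+ 2 * l%:R / 8)) * #|B|%:R ^+ l.
Proof.
move=> dl0 dl1.
have l0' : 0 < l%:R :> R by rewrite ltr0n.
have b0 : 0 < #|B|%:R :> R by rewrite ltr0n.
pose X b := f (y - b) - smooth y.
have X0 : \sum_(b in B) X b = 0.
  rewrite big_split /= sumrN sumr_const -mulr_natr /smooth mulfVK ?gt_eqF //.
  by rewrite subrr.
have X1 b : b \in B -> `|X b| <= 1.
  move=> _; have := f01 (y - b); have := smooth01 y.
  by rewrite ler_norml /X => /andP[? ?] /andP[? ?]; apply/andP; split; lra.
have h1 := sampling_tail l dl0 dl1 X1 X0.
have h2 := @sampling_tail R G B l (fun b => - X b) dl dl0 dl1.
have {}h2 : #|[set u in samples B l | dl * l%:R < \sum_i - X (u i)]|%:R <=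
  #|B|%:R ^+ l * expR (- (dl ^+ 2 * l%:R / 8)).
  by apply: h2 => [b /X1|]; rewrite ?normrN // sumrN X0 oppr0.
apply: (@le_trans _ _ (#|[set u in samples B l | dl * l%:R < \sum_i X (u i)]|%:R +
   #|[set u in samples B l | dl * l%:R < \sum_i - X (u i)]|%:R)); last first.
  by move: h1 h2; move: (_ ^+ l) (expR _) => a b h1 h2; lra.
rewrite -natrD ler_nat; apply: leq_trans (leq_of_leqif (leq_card_setU _ _)).
apply/subset_leq_card/fintype.subsetP => u; rewrite !inE => /andP[-> /=].
have -> : \sum_i - X (u i) = - \sum_i X (u i) by rewrite sumrN.
have -> : \sum_i X (u i) = (empirical u y - smooth y) * l%:R.
  rewrite big_split /= sumr_const card_ord mulrBl /empirical mulfVK ?gt_eqF //.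
  by rewrite mulNrn mulr_natr.
by rewrite -[- (_ * l%:R)]mulNr !ltr_pM2r // distrC ltr_normr.
Qed.

(* By pigeonhole some [u] has many diagonal translates among the good samples, and
   all of them approximate [smooth] by translates of the same [empirical u]. *)
Lemma exists_almost_periods (dl eta : R) : 0 <= dl -> dl <= 1 ->
  4 * expR (- (dl ^+ 2 * l%:R / 8)) <= eta ->
  exists (S : {set G}) (phi : G -> R),
  [/\ forall y, 0 <= phi y <= 1,
      (#|B|%:R / #|G|%:R) ^+ l * #|G|%:R <= 2 * #|S|%:R :> R &
      forall t, t \in S ->
        #|[set y | dl < `|smooth (y - t) - phi y|]|%:R <= eta * #|G|%:R].
Proof.
move=> dl0 dl1 heta.
have N0 : 0 < #|G|%:R :> R by rewrite ltr0n; apply/card_gt0P; exists 0.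
have e0 : 0 < eta by apply: lt_le_trans heta; rewrite mulr_gt0 ?expR_gt0.
have b0 : 0 < #|B|%:R :> R by rewrite ltr0n.
pose bad (u : {ffun 'I_l -> G}) := [set y | dl < `|smooth y - empirical u y|].
pose L := [set u in samples B l | (#|bad u|%:R : R) <= eta * #|G|%:R].
have hbad : \sum_(u in samples B l) #|bad u|%:R <= eta / 2 * #|G|%:R * #|B|%:R ^+ l.
  rewrite (eq_bigr (fun u => \sum_y (dl < `|smooth y - empirical u y|)%R%:R)); last first.
    by move=> u _; rewrite natr_card_setE.
  rewrite exchange_big /=.
  apply: (@le_trans _ _ (\sum_(y : G) (eta / 2 * #|B|%:R ^+ l))); last first.
    by rewrite sumr_const -[leLHS]mulr_natr mulrAC.
  apply: ler_sum => y _.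
  rewrite -natr_card_setIdE; apply: le_trans (empirical_tail y dl0 dl1) _.
  by apply: ler_wpM2r; [rewrite exprn_ge0 | lra].
(* Markov's inequality: the average bad set has at most half the allowed size, so at least half of
   the samples are good. *)
have hL : #|B|%:R ^+ l <= 2 * #|L|%:R :> R.
  have h1 : (#|samples B l|%:R - #|L|%:R) * (eta * #|G|%:R) <=
      \sum_(u in samples B l) #|bad u|%:R.
    rewrite natr_card_setIdE -[#|samples B l|%:R]sumr_const -sumrB mulr_suml.
    apply: ler_sum => u _.
    case: (leP #|bad u|%:R (eta * #|G|%:R)) => h; first by rewrite subrr mul0r.
    by rewrite subr0 mul1r ltW.
  have := le_trans h1 hbad; rewrite card_samples.
  rewrite [X in _ <= X](_ : _ = (#|B|%:R ^+ l / 2) * (eta * #|G|%:R)); last by field.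
  by rewrite ler_pM2r ?mulr_gt0 //; lra.
(* For each [t], every good sample is [u - [ffun=> t]] for exactly one [u]; hence the sets [per u]
   have total size [#|G| * #|L|]. *)
pose per (u : {ffun 'I_l -> G}) := [set t | u - [ffun=> t] \in L].
have [||u hu] := @ex_le_of_sum_le R {ffun 'I_l -> G} (fun u => #|per u|%:R)
   (#|G|%:R * #|L|%:R / #|G|%:R ^+ l).
- by apply/card_gt0P; exists 0.
- rewrite card_ffun card_ord natrX mulfVK ?expf_neq0 ?gt_eqF //.
  rewrite mulr_natl -sumr_const.
  rewrite [leRHS](eq_bigr (fun u => \sum_t (u - [ffun=> t] \in L)%:R)); last first.
    by move=> u _; rewrite natr_card_setE.
  rewrite exchange_big /=; apply: ler_sum => t _.
  rewrite (reindex_inj (addIr [ffun=> t])) /= -sum1_card natr_sum big_mkcond /=.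
  apply: ler_sum => u _; rewrite addrK; by case: ifP.
exists (per u), (empirical u); split.
- exact: empirical01.
- apply: (@le_trans _ _ (2 * (#|G|%:R * #|L|%:R / #|G|%:R ^+ l))); last by rewrite ler_pM2l.
  rewrite expr_div_n mulrAC [X in _ <= X]mulrA; apply: ler_wpM2r.
    by rewrite invr_ge0 exprn_ge0 ?ltW.
  by rewrite mulrC [leRHS]mulrCA ler_pM2l.
- move=> t; rewrite inE => /[!inE] /andP[_]; apply: le_trans; rewrite ler_nat.
  (* The estimate from [u - [ffun=> t]] at [y] is the one from [u] at [y + t], so the bad set is
     merely translated by [t]. *)
  rewrite -(card_imset _ (addIr t)); apply/subset_leq_card/fintype.subsetP => y.
  rewrite inE => hy; apply/imsetP; exists (y - t); last by rewrite subrK.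
  rewrite inE; move: hy; congr (_ < `|_ - _ / _|); apply: eq_bigr => i _.
  by rewrite !ffunE opprB addrA subrK.
Qed.

End Empirical.
End AlmostPeriods.

(** * Characters of a finite field as real pairs *)

Section CircleHom.
Variable R : realType.

(* [c] and [s] are the real and imaginary parts of a homomorphism from [G] to
   the unit circle. *)
Record circle_hom (G : zmodType) (c s : G -> R) : Prop := CircleHom {
  circle_norm : forall a, c a ^+ 2 + s a ^+ 2 = 1;
  circle_cosD : forall a b, c (a + b) = c a * c b - s a * s b;
  circle_sinD : forall a b, s (a + b) = s a * c b + c a * s b }.

Section Zmod.
Variables (G : zmodType) (c s : G -> R).
Hypothesis h : circle_hom c s.

Lemma circle_cos0 : c 0 = 1.
Proof.
have n0 := circle_norm h 0; have c0 := circle_cosD h 0 0; have s0 := circle_sinD h 0 0.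
rewrite addr0 in c0 s0; move: n0 c0 s0; move: (c 0) (s 0) => x y; nra.
Qed.

Lemma circle_sin0 : s 0 = 0.
Proof.
have n0 := circle_norm h 0; move: n0; rewrite circle_cos0 expr1n.
by move/eqP; rewrite -subr_eq0 addrAC subrr add0r sqrf_eq0 => /eqP.
Qed.

Lemma circle_cosN a : c (- a) = c a.
Proof.
have := circle_cosD h a (- a); have := circle_sinD h a (- a).
rewrite subrr circle_cos0 circle_sin0 => e1 e2; have n := circle_norm h a.
move: e1 e2 n; move: (c (- a)) (s (- a)) (c a) (s a) => x y z w e1 e2 n.
have -> : x = x * (z ^+ 2 + w ^+ 2) by rewrite n mulr1.
have -> : x * (z ^+ 2 + w ^+ 2) = z * (z * x - w * y) + w * (w * x + z * y) by ring.
by rewrite -e1 -e2 mulr1 mulr0 addr0.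
Qed.

Lemma circle_sinN a : s (- a) = - s a.
Proof.
have := circle_cosD h a (- a); have := circle_sinD h a (- a).
rewrite subrr circle_cos0 circle_sin0 => e1 e2; have n := circle_norm h a.
move: e1 e2 n; move: (c (- a)) (s (- a)) (c a) (s a) => x y z w e1 e2 n.
have -> : y = y * (z ^+ 2 + w ^+ 2) by rewrite n mulr1.
have -> : y * (z ^+ 2 + w ^+ 2) = z * (w * x + z * y) - w * (z * x - w * y) by ring.
by rewrite -e1 -e2 mulr1 mulr0 sub0r.
Qed.

Lemma circle_cosB a b : c (a - b) = c a * c b + s a * s b.
Proof. by rewrite (circle_cosD h) circle_cosN circle_sinN mulrN opprK. Qed.

Lemma circle_sinB a b : s (a - b) = s a * c b - c a * s b.
Proof. by rewrite (circle_sinD h) circle_cosN circle_sinN mulrN. Qed.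

Lemma circle_combo_le1 (x y : R) a : x ^+ 2 + y ^+ 2 = 1 -> `|x * c a + y * s a| <= 1.
Proof.
move=> e; have n := circle_norm h a; rewrite -(@ler_pXn2r _ 2) ?nnegrE ?normr_ge0 //.
rewrite expr1n real_normK ?num_real //.
have -> : 1 = (x ^+ 2 + y ^+ 2) * (c a ^+ 2 + s a ^+ 2) by rewrite e n mulr1.
have := sqr_ge0 (x * s a - y * c a).
move: (c a) (s a) => z w; nra.
Qed.

End Zmod.

Lemma circle_comp (G G' : zmodType) (c s : G -> R) (f : G' -> G) :
  circle_hom c s -> (forall a b, f (a + b) = f a + f b) ->
  circle_hom (c \o f) (s \o f).
Proof.
move=> h fD; split=> [a|a b|a b] /=; first exact: (circle_norm h).
  by rewrite fD (circle_cosD h).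
by rewrite fD (circle_sinD h).
Qed.

(** Translation by [a0] rotates the vector [(C, S)] without changing it. The rotation minus the
    identity has determinant [(x - 1) ^+ 2 + y ^+ 2], which is nonzero. *)
Lemma circle_sum0 (G : finZmodType) (c s : G -> R) a0 :
  circle_hom c s -> c a0 != 1 -> \sum_a c a = 0 /\ \sum_a s a = 0.
Proof.
move=> h ca0; set C := \sum_a c a; set S := \sum_a s a.
have eC : C = C * c a0 - S * s a0.
  rewrite {1}/C (reindex_inj (addIr a0)) /=.
  under eq_bigr => a _ do rewrite (circle_cosD h).
  by rewrite sumrB -!mulr_suml.
have eS : S = S * c a0 + C * s a0.
  rewrite {1}/S (reindex_inj (addIr a0)) /=.
  under eq_bigr => a _ do rewrite (circle_sinD h).
  by rewrite big_split /= -!mulr_suml.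
move: eC eS ca0; move: (c a0) (s a0) => x y eC eS.
rewrite -subr_eq0 => ca0.
have d0 : (x - 1) ^+ 2 + y ^+ 2 != 0.
  by rewrite gt_eqF // ltr_pwDl ?sqr_ge0 // lt_neqAle sqr_ge0 eq_sym sqrf_eq0 ca0.
have e1 : C * (x - 1) - S * y = 0 by lra.
have e2 : S * (x - 1) + C * y = 0 by lra.
split; apply/eqP; [rewrite -(mulIr_eq0 _ (mulIf d0)) | rewrite -(mulIr_eq0 _ (mulIf d0))]; apply/eqP.
  have -> : C * ((x - 1) ^+ 2 + y ^+ 2) = (C * (x - 1) - S * y) * (x - 1) + (S * (x - 1) + C * y) * y by ring.
  by rewrite e1 e2 !mul0r addr0.
have -> : S * ((x - 1) ^+ 2 + y ^+ 2) = (S * (x - 1) + C * y) * (x - 1) - (C * (x - 1) - S * y) * y by ring.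
by rewrite e1 e2 !mul0r subr0.
Qed.

End CircleHom.

Section Character.
Variables (R : realType) (K : finFieldType).

(** View [K] as a vector space over its prime field and send one coordinate [m] to the angle
    [2 * pi * m / p]. *)
Lemma exists_circle_hom :
  exists c s : K -> R, circle_hom c s /\ exists a, c a != 1.
Proof.
have [p pr_p charKp] := finPcharP K.
pose L := pPrimeCharType charKp.
have p1 : (1 < p)%N := prime_gt1 pr_p.
have p0' : 0 < p%:R :> R by rewrite ltr0n prime_gt0.
pose th : R := pi *+ 2 / p%:R.
pose cn (m : nat) := cos (th * m%:R).
pose sn (m : nat) := sin (th * m%:R).
have per m k : cn (m + k * p)%N = cn m /\ sn (m + k * p)%N = sn m.
  rewrite /cn /sn natrD natrM mulrDr mulrCA.
  rewrite (_ : th * p%:R = pi *+ 2); last by rewrite /th mulfVK // gt_eqF.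
  elim: k => [|k [IH1 IH2]]; first by rewrite mul0r addr0.
  by rewrite -natr1 mulrDl mul1r addrA cosD2pi sinD2pi.
have md m : cn (m %% p)%N = cn m /\ sn (m %% p)%N = sn m.
  have [h1 h2] := per (m %% p)%N (m %/ p)%N.
  by rewrite -h1 -h2 addnC -divn_eq.
pose b := vbasis {:L}; pose i0 := Ordinal (adim_gt0 {:L}).
pose e (x : K) : nat := coord b i0 (x : L).
have eD x y : e (x + y) = ((e x + e y) %% p)%N.
  by rewrite /e linearD /= [X in (_ %% X)%N]Fp_cast.
exists (cn \o e), (sn \o e); split.
  split=> [a|a a'|a a'] /=; first exact: cos2Dsin2.
    by rewrite eD (md _).1 /cn natrD mulrDr cosD.
  by rewrite eD (md _).2 /sn natrD mulrDr sinD.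
(* The first basis vector has coordinate [1] and hence angle [th]; here [0 < th <= pi], with
   [th = pi] treated separately. *)
exists (b`_0 : L) => /=.
rewrite /cn /e (coord_free i0 i0) ?(basis_free (vbasisP _)) // eqxx mulr1.
have th0 : 0 < th by rewrite divr_gt0 // mulrn_wgt0 // pi_gt0.
have thpi : th <= pi.
  by rewrite ler_pdivrMr // -[leLHS]mulr_natr ler_pM2l ?pi_gt0 // ler_nat.
move: thpi; rewrite le_eqVlt => /orP[/eqP->|thpi].
  by rewrite cospi; lra.
have s0 : 0 < sin th by apply: sin_gt0_pi; rewrite th0.
apply/eqP => c1; have := cos2Dsin2 th; rewrite c1 => h.
by move: s0 h; move: (sin th) => y; nra.
Qed.

End Character.

(** * Fourier analysis on F_q^n *)

Section Dot.
Variables (K : finFieldType) (n : nat).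
Local Notation V := 'rV[K]_n.

Definition dot (v x : V) : K := \sum_i v 0 i * x 0 i.

Lemma dotDr v x y : dot v (x + y) = dot v x + dot v y.
Proof. by rewrite /dot -big_split /=; apply: eq_bigr => i _; rewrite mxE mulrDr. Qed.

Lemma dotDl v w x : dot (v + w) x = dot v x + dot w x.
Proof. by rewrite /dot -big_split /=; apply: eq_bigr => i _; rewrite mxE mulrDl. Qed.

Lemma dotZr v a x : dot v (a *: x) = a * dot v x.
Proof. by rewrite /dot mulr_sumr; apply: eq_bigr => i _; rewrite mxE mulrCA. Qed.

Lemma dotZl v a x : dot (a *: v) x = a * dot v x.
Proof. by rewrite /dot mulr_sumr; apply: eq_bigr => i _; rewrite mxE mulrA. Qed.

Lemma dotBr v x y : dot v (x - y) = dot v x - dot v y.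
Proof. by rewrite dotDr -scaleN1r dotZr mulN1r. Qed.

Lemma dot_nondegenerate x : x != 0 -> exists v, dot v x != 0.
Proof.
move=> x0; have [i xi] : exists i, x 0 i != 0.
  apply/existsP; apply: contraR x0; rewrite negb_exists => /forallP h.
  by apply/eqP/rowP => i; rewrite mxE; apply/eqP; rewrite -[_ == _]negbK h.
exists (delta_mx 0 i); rewrite /dot (bigD1 i) //= mxE !eqxx mul1r.
rewrite big1 ?addr0 // => j ji; by rewrite mxE eqxx (negbTE ji) mul0r.
Qed.

(** Written as the kernel of a matrix whose columns are the vectors of [s], so that the codimension
    bound is rank-nullity. *)
Definition annihilator (s : seq V) : {vspace V} :=
  lker (linfun (@mulmxr K 1 _ _ (\matrix_(i < n, j < size s) s`_j 0 i))).

Lemma mem_annihilator s x :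
  reflect (forall v, v \in s -> dot v x = 0) (x \in annihilator s).
Proof.
have E (j : 'I_(size s)) : (x *m \matrix_(i < n, j < size s) s`_j 0 i) 0 j = dot s`_j x.
  by rewrite mxE; apply: eq_bigr => i _; rewrite mxE mulrC.
rewrite memv_ker lfunE /=; apply: (iffP eqP) => [h v vs | h].
  have js : (index v s < size s)%N by rewrite index_mem.
  by have := E (Ordinal js); rewrite h mxE /= nth_index // => <-.
by apply/rowP => j; rewrite E mxE; apply: h; exact: mem_nth.
Qed.

Lemma codim_annihilator s : (n - \dim (annihilator s) <= size s)%N.
Proof.
have := limg_ker_dim (linfun (@mulmxr K 1 _ _ (\matrix_(i < n, j < size s) s`_j 0 i))) fullv.
rewrite capfv -/(annihilator s) dimvf /dim /= mul1n => E.
rewrite leq_subLR; apply: leq_trans (eq_leq (esym E)) _; rewrite leq_add2l.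
by apply: leq_trans (dimvS (subvf _)) _; rewrite dimvf /dim /= mul1n.
Qed.

(* Linear independence in the triangular form produced by a greedy choice. *)
Fixpoint independent (s : seq V) : Prop :=
  if s is v :: s' then
    (exists2 u, u \in annihilator s' & dot v u != 0) /\ independent s'
  else True.

(** As long as some form in [S] is nonzero on the annihilator of the list, it can be prepended; the
    length bound [m] makes this stop. *)
Lemma exists_maximal_independent (S : pred V) m :
  (forall s, independent s -> all S s -> (size s <= m)%N) ->
  exists s, [/\ independent s, all S s &
    forall v x, S v -> x \in annihilator s -> dot v x = 0].
Proof.
move=> hm.
have [k [s [hk i_s Ss]]] : exists k s, [/\ (m - size s <= k)%N, independent s & all S s].
  by exists m, [::]; split; rewrite ?subn0.
elim: k s hk i_s Ss => [|k IH] s hk i_s Ss.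
  exists s; split=> // v x Sv xs; apply/eqP; apply: contraT => vx.
  have := hm (v :: s); rewrite /= Sv Ss => /(_ (conj (ex_intro2 _ _ x xs vx) i_s) isT).
  by move: hk; rewrite leqn0 subn_eq0 ltnNge => ->.
have [h|/existsNP[v /existsNP[x /not_implyP[Sv /not_implyP[xs /eqP vx]]]]] :=
  pselect (forall v x, S v -> x \in annihilator s -> dot v x = 0).
  by exists s.
apply: (IH (v :: s)); rewrite /= ?Sv //; last by split=> //; exists x.
by rewrite subnS -ltnS; case: (m - size s)%N hk.
Qed.

End Dot.

Section Fourier.
Variables (R : realType) (K : finFieldType) (n : nat) (c s : K -> R).
Hypothesis cs : circle_hom c s.
Hypothesis cs1 : exists a, c a != 1.
Local Notation V := 'rV[K]_n.

(** [fcos] and [fsin] are the real and imaginary parts of an unnormalised Fourier coefficient. *)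
Definition fcos (f : V -> R) (v : V) : R := \sum_x f x * c (dot v x).
Definition fsin (f : V -> R) (v : V) : R := \sum_x f x * s (dot v x).

Let csl x : circle_hom (c \o (@dot K n)^~ x) (s \o (@dot K n)^~ x) :=
  circle_comp cs (fun v w => dotDl v w x).

Lemma sum_cos_dot (x : V) : \sum_v c (dot v x) = #|{: V}|%:R * (x == 0)%:R.
Proof.
have [->|x0] := eqVneq x 0.
  rewrite (eq_bigr (fun=> 1)); first by rewrite sumr_const mulr1.
  move=> v _; rewrite (_ : dot v 0 = 0) ?(circle_cos0 cs) //.
  by rewrite /dot big1 // => i _; rewrite mxE mulr0.
rewrite mulr0; have [v vx] := dot_nondegenerate x0; have [a ca] := cs1.
have h : (c \o (@dot K n)^~ x) ((a / dot v x) *: v) != 1.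
  by rewrite /= dotZl mulfVK.
by have [] := circle_sum0 (csl x) h.
Qed.

(** Expanding the squares produces [c (dot v (x - y))]; orthogonality over [v] leaves only the
    diagonal [x = y]. *)
Lemma parseval (f : V -> R) :
  \sum_v (fcos f v ^+ 2 + fsin f v ^+ 2) = #|{: V}|%:R * \sum_x f x ^+ 2.
Proof.
transitivity (\sum_v \sum_x \sum_y f x * f y * c (dot v (x - y))).
  apply: eq_bigr => v _; rewrite !expr2 /fcos /fsin !mulr_suml -big_split /=.
  apply: eq_bigr => x _; rewrite !mulr_sumr -big_split /=; apply: eq_bigr => y _.
  by rewrite dotBr (circle_cosB cs); ring.
rewrite exchange_big /= mulr_sumr; apply: eq_bigr => x _.
rewrite exchange_big /= (bigD1 x) //= -mulr_sumr sum_cos_dot subrr eqxx mulr1.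
rewrite big1 ?addr0; first by rewrite mulrC expr2.
move=> y yx; rewrite -mulr_sumr sum_cos_dot subr_eq0 eq_sym (negbTE yx).
by rewrite mulr0 mulr0.
Qed.

Lemma fcos_translate f v a :
  fcos (fun x => f (x + a)) v = fcos f v * c (dot v a) + fsin f v * s (dot v a).
Proof.
rewrite /fcos (reindex_inj (addIr (- a))) /= /fsin !mulr_suml -big_split /=.
by apply: eq_bigr => x _; rewrite subrK dotBr (circle_cosB cs); ring.
Qed.

Lemma fsin_translate f v a :
  fsin (fun x => f (x + a)) v = fsin f v * c (dot v a) - fcos f v * s (dot v a).
Proof.
rewrite /fsin (reindex_inj (addIr (- a))) /= /fcos !mulr_suml -sumrB.
by apply: eq_bigr => x _; rewrite subrK dotBr (circle_sinB cs); ring.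
Qed.

Lemma fcos_sum (I : finType) (P : pred I) (F : I -> V -> R) (k : R) v :
  fcos (fun x => (\sum_(i | P i) F i x) / k) v = (\sum_(i | P i) fcos (F i) v) / k.
Proof.
rewrite /fcos exchange_big /= mulr_suml; apply: eq_bigr => x _.
by rewrite mulrAC mulr_suml.
Qed.

Lemma fsin_sum (I : finType) (P : pred I) (F : I -> V -> R) (k : R) v :
  fsin (fun x => (\sum_(i | P i) F i x) / k) v = (\sum_(i | P i) fsin (F i) v) / k.
Proof.
rewrite /fsin exchange_big /= mulr_suml; apply: eq_bigr => x _.
by rewrite mulrAC mulr_suml.
Qed.

Section Averaging.
Variable T : {set V}.

(** Averaging over differences rather than over [T] makes the kernel symmetric, so each Fourier
    coefficient is multiplied by a real non-negative number. *)
Definition davg (f : V -> R) (x : V) : R :=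
  (\sum_(q in finset.setX T T) f (x + (q.1 - q.2))) / #|T|%:R ^+ 2.

(* Squared modulus of the Fourier coefficient at [v] of the uniform measure on [T]. *)
Definition davg_eig (v : V) : R :=
  ((\sum_(t in T) c (dot v t)) ^+ 2 + (\sum_(t in T) s (dot v t)) ^+ 2) / #|T|%:R ^+ 2.

Lemma sum_setX_split (F : V -> V -> R) :
  \sum_(q in finset.setX T T) F q.1 q.2 = \sum_(t in T) \sum_(t' in T) F t t'.
Proof.
by rewrite pair_big /=; apply: eq_bigl => -[t t']; rewrite !inE.
Qed.

Lemma sum_cos_diff v : \sum_(q in finset.setX T T) c (dot v (q.1 - q.2)) =
  (\sum_(t in T) c (dot v t)) ^+ 2 + (\sum_(t in T) s (dot v t)) ^+ 2.
Proof.
rewrite (sum_setX_split (fun t t' => c (dot v (t - t')))) !expr2 !mulr_suml -big_split /=.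
apply: eq_bigr => t _; rewrite !mulr_sumr -big_split /=; apply: eq_bigr => t' _.
by rewrite dotBr (circle_cosB cs).
Qed.

Lemma sum_sin_diff v : \sum_(q in finset.setX T T) s (dot v (q.1 - q.2)) = 0.
Proof.
rewrite (sum_setX_split (fun t t' => s (dot v (t - t')))).
transitivity ((\sum_(t in T) s (dot v t)) * (\sum_(t in T) c (dot v t)) -
  (\sum_(t in T) c (dot v t)) * (\sum_(t in T) s (dot v t))); last by ring.
rewrite !mulr_suml -sumrB; apply: eq_bigr => t _; rewrite !mulr_sumr -sumrB.
by apply: eq_bigr => t' _; rewrite dotBr (circle_sinB cs).
Qed.

Lemma fcos_davg f v : fcos (davg f) v = davg_eig v * fcos f v.
Proof.
rewrite /davg fcos_sum; under eq_bigr => q _ do rewrite fcos_translate.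
rewrite big_split /= -!mulr_sumr sum_cos_diff sum_sin_diff mulr0 addr0.
by rewrite /davg_eig -mulrA [LHS]mulrC.
Qed.

Lemma fsin_davg f v : fsin (davg f) v = davg_eig v * fsin f v.
Proof.
rewrite /davg fsin_sum; under eq_bigr => q _ do rewrite fsin_translate.
rewrite sumrB /= -!mulr_sumr sum_cos_diff sum_sin_diff mulr0 subr0.
by rewrite /davg_eig -mulrA [LHS]mulrC.
Qed.

(** By Parseval it suffices to look at one frequency: either [f] has no mass there, or each step
    multiplies the coefficient by at most [1 / 4], hence its square by [1 / 16]. *)
Lemma iter_davg_l2 k (f : V -> R) :
  (forall v, 1 / 4 < davg_eig v -> fcos f v = 0 /\ fsin f v = 0) ->
  \sum_x iter k davg f x ^+ 2 <= (1 / 16) ^+ k * \sum_x f x ^+ 2.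
Proof.
move=> hf; have N0 : 0 < #|{: V}|%:R :> R by rewrite ltr0n; apply/card_gt0P; exists 0.
have Ek v : fcos (iter k davg f) v = davg_eig v ^+ k * fcos f v /\
            fsin (iter k davg f) v = davg_eig v ^+ k * fsin f v.
  elim: k => [|k [IH1 IH2]]; first by rewrite !expr0 !mul1r.
  by rewrite /= fcos_davg fsin_davg IH1 IH2 !mulrA exprS.
rewrite -(ler_pM2l N0) mulrCA -!parseval mulr_sumr; apply: ler_sum => v _.
have [-> ->] := Ek v.
have [h|h] := ltP (1 / 4) (davg_eig v).
  by have [-> ->] := hf v h; rewrite !mulr0 expr0n /= !addr0 mulr0.
have e0 : 0 <= davg_eig v by rewrite divr_ge0 ?exprn_ge0 // addr_ge0 ?sqr_ge0.
move: h e0; move: (davg_eig v) (fcos f v) (fsin f v) => z a b h z0.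
rewrite ![in leLHS]exprMn -mulrDr; apply: ler_wpM2r; first by rewrite addr_ge0 ?sqr_ge0.
rewrite -exprM mulnC exprM.
have h2 : z ^+ 2 <= 1 / 16 by nra.
by apply: lerXn2r; rewrite ?nnegrE ?sqr_ge0.
Qed.

End Averaging.

End Fourier.

(** * Chang's theorem *)

Lemma size_mul_le_sum (R : realType) (T : eqType) (L : seq T) (F : T -> R) (k : R) :
  (forall v, v \in L -> k <= F v) -> (size L)%:R * k <= \sum_(v <- L) F v.
Proof.
elim: L => [|v L IH] h; first by rewrite big_nil mul0r.
rewrite big_cons /= -natr1 mulrDl mul1r addrC; apply: lerD.
  by apply: h; rewrite mem_head.
by apply: IH => w wL; apply: h; rewrite inE wL orbT.
Qed.

Section Chang.
Variables (R : realType) (K : finFieldType) (n : nat) (c s : K -> R).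
Hypothesis cs : circle_hom c s.
Hypothesis cs1 : exists a, c a != 1.
Local Notation V := 'rV[K]_n.

(* Independent linear forms take independent uniform values, so the exponential
   moment of the sum factorises. *)
Lemma independent_mgf_le (a b : V -> R) (lam : R) (L : seq V) :
  `|lam| <= 1 / 2 -> independent L -> (forall v, v \in L -> a v ^+ 2 + b v ^+ 2 = 1) ->
  \sum_x \prod_(v <- L) expR (lam * (a v * c (dot v x) + b v * s (dot v x))) <=
  #|{: V}|%:R * expR (2 * lam ^+ 2) ^+ size L.
Proof.
move=> hlam; elim: L => [|v L IH] /=.
  move=> _ _; under eq_bigr => x _ do rewrite big_nil.
  by rewrite sumr_const expr0 mulr1.
move=> [[u uL vu] iL] hab.
have {}IH := IH iL (fun w wL => hab w (mem_behead (s := v :: L) wL)).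
have hv : a v ^+ 2 + b v ^+ 2 = 1 by apply: hab; rewrite mem_head.
pose e (w : V) (t : K) := expR (lam * (a w * c t + b w * s t)).
pose Phi (x : V) := \prod_(w <- L) e w (dot w x).
have Phi0 x : 0 <= Phi x by apply: prodr_ge0 => w _; exact: expR_ge0.
have q0 : 0 < #|K|%:R :> R by rewrite ltr0n; apply/card_gt0P; exists 0.
have he : \sum_t e v t <= #|K|%:R * expR (2 * lam ^+ 2).
  have [a0 ca0] := cs1; have [sc0 ss0] := circle_sum0 cs ca0.
  have := @mgf_le R K [set: K] (fun t => a v * c t + b v * s t) lam hlam.
  have sT F : \sum_(t in [set: K]) F t = \sum_t F t :> R.
    by apply: eq_bigl => t; rewrite inE.
  rewrite cardsT !sT; apply; first by move=> t _; exact: circle_combo_le1.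
  by rewrite big_split /= -!mulr_sumr sc0 ss0 !mulr0 addr0.
(* Moving [x] along [u] leaves the forms of [L] fixed while [dot v x] runs through all of [K]. *)
have E : #|K|%:R * (\sum_x Phi x * e v (dot v x)) = \sum_x Phi x * \sum_t e v t.
  rewrite mulr_natl -sumr_const.
  transitivity (\sum_(t : K) \sum_x Phi x * e v (dot v x + t * dot v u)).
    apply: eq_bigr => t _; rewrite (reindex_inj (addIr (t *: u))) /=.
    apply: eq_bigr => x _; rewrite dotDr dotZr; congr (_ * _).
    rewrite /Phi big_seq [RHS]big_seq; apply: eq_bigr => w wL.
    by rewrite dotDr dotZr (mem_annihilator _ _ uL w wL) mulr0 addr0.
  rewrite exchange_big /=; apply: eq_bigr => x _; rewrite -mulr_sumr; congr (_ * _).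
  rewrite [RHS](reindex (fun t => dot v x + t * dot v u)) //=.
  exists (fun t => (t - dot v x) / dot v u) => t _.
    by rewrite addrAC subrr add0r mulfK.
  by rewrite mulfVK // addrC subrK.
rewrite (eq_bigr (fun x => Phi x * e v (dot v x))); last first.
  by move=> x _; rewrite big_cons mulrC.
rewrite -(ler_pM2l q0) E -mulr_suml exprS.
apply: (@le_trans _ _ ((#|{: V}|%:R * expR (2 * lam ^+ 2) ^+ size L) * (#|K|%:R * expR (2 * lam ^+ 2)))).
  apply: ler_pM => //; first by apply: sumr_ge0.
  by apply: sumr_ge0 => t _; exact: expR_ge0.
by rewrite le_eqVlt; apply/orP; left; apply/eqP; move: (_ ^+ size L) => y; ring.
Qed.

(** Align the characters in [L] with the phases of their coefficients on [T]. Their sum [X] then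
    averages at least [size L / 2] over [T], whereas independence keeps its exponential moment over
    the whole space small. At parameter [1 / 8] the exponents are [size L / 16] and
    [size L / 32]. *)
Lemma chang (T : {set V}) (L : seq V) : (0 < #|T|)%N ->
  independent L -> all (fun v => 1 / 4 < davg_eig c s T v) L ->
  expR ((size L)%:R / 32) * #|T|%:R <= #|{: V}|%:R :> R.
Proof.
move=> T0 iL /allP specL.
have t0 : 0 < #|T|%:R :> R by rewrite ltr0n.
pose C v := \sum_(t in T) c (dot v t); pose S v := \sum_(t in T) s (dot v t).
pose r v := Num.sqrt (C v ^+ 2 + S v ^+ 2).
pose a v := C v / r v; pose b v := S v / r v.
have rP v : v \in L -> #|T|%:R / 2 <= r v.
  move=> /specL; rewrite /davg_eig -/(C v) -/(S v) ltr_pdivlMr ?exprn_gt0 // => h.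
  have t2 : 0 <= #|T|%:R / 2 :> R by lra.
  rewrite -(@ler_pXn2r _ 2) ?nnegrE ?sqrtr_ge0 //.
  rewrite /r sqr_sqrtr ?addr_ge0 ?sqr_ge0 //; apply: ltW; apply: le_lt_trans h.
  by rewrite le_eqVlt; apply/orP; left; apply/eqP; field.
have r0 v : v \in L -> 0 < r v.
  by move=> /rP; apply: lt_le_trans; rewrite divr_gt0.
have r2 v : r v ^+ 2 = C v ^+ 2 + S v ^+ 2.
  by rewrite /r sqr_sqrtr ?addr_ge0 ?sqr_ge0.
have hab v : v \in L -> a v ^+ 2 + b v ^+ 2 = 1.
  move=> /r0 rv; rewrite /a /b !expr_div_n -mulrDl -r2 divff // expf_neq0 //.
  by rewrite gt_eqF.
pose X x := \sum_(v <- L) (a v * c (dot v x) + b v * s (dot v x)).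
have hX : (size L)%:R * (#|T|%:R / 2) <= \sum_(t in T) X t.
  rewrite exchange_big /=; apply: size_mul_le_sum => v vL.
  rewrite big_split /= -!mulr_sumr -/(C v) -/(S v).
  have -> : a v * C v + b v * S v = r v; last exact: rP.
  rewrite /a /b mulrAC [S v / _ * _]mulrAC -mulrDl -!expr2 -r2 expr2 mulfK //.
  by rewrite gt_eqF // r0.
(* Jensen's inequality, obtained from the tangent to [expR] at [size L / 16]. *)
have lo : expR ((size L)%:R / 16) * #|T|%:R <= \sum_(t in T) expR (1 / 8 * X t).
  apply: (@le_trans _ _ (\sum_(t in T)
      expR ((size L)%:R / 16) * (1 - (size L)%:R / 16 + 1 / 8 * X t))); last first.
    apply: ler_sum => t _.
    rewrite -[1 / 8 * X t](subrKC ((size L)%:R / 16)) expRD.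
    apply: ler_wpM2l; first exact: expR_ge0.
    by apply: le_trans (expR_ge1Dx _); rewrite subrKC addrA addrAC.
  rewrite -mulr_sumr; apply: ler_wpM2l; first exact: expR_ge0.
  rewrite big_split /= sumr_const -mulr_sumr -[_ *+ #|T|]mulr_natr.
  by move: hX; move: (\sum_(t in T) X t) => z; lra.
have up : \sum_(t in T) expR (1 / 8 * X t) <= #|{: V}|%:R * expR ((size L)%:R / 32).
  apply: (@le_trans _ _ (\sum_x expR (1 / 8 * X x))).
    rewrite [leRHS](bigID (fun x => x \in T)) /= lerDl.
    by apply: sumr_ge0 => x _; exact: expR_ge0.
  rewrite (eq_bigr (fun x => \prod_(v <- L)
     expR (1 / 8 * (a v * c (dot v x) + b v * s (dot v x))))); last first.
    by move=> x _; rewrite mulr_sumr expR_sum.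
  apply: le_trans (independent_mgf_le _ iL hab) _; first by rewrite ger0_norm; lra.
  rewrite -expRM_natl ler_wpM2l // ler_expR le_eqVlt; apply/orP; left; apply/eqP.
  by field.
have := le_trans lo up.
rewrite (_ : (size L)%:R / 16 = (size L)%:R / 32 + (size L)%:R / 32 :> R); last by field.
by rewrite expRD -mulrA [leRHS]mulrC ler_pM2l ?expR_gt0.
Qed.
End Chang.

(** * Almost periodicity along a subspace *)

Section MeanOver.
Variables (R : realType) (T : finType).

Definition mean (A : {set T}) (f : T -> R) : R := (\sum_(a in A) f a) / #|A|%:R.

Variable A : {set T}.
Hypothesis A0 : (0 < #|A|)%N.

Let a0 : 0 < #|A|%:R :> R. Proof. by rewrite ltr0n. Qed.

Lemma meanB f g : mean A (fun x => f x - g x) = mean A f - mean A g.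
Proof. by rewrite /mean sumrB mulrBl. Qed.

Lemma mean_cst k : mean A (fun=> k) = k.
Proof. by rewrite /mean sumr_const -[X in X / _]mulr_natr mulfK // gt_eqF. Qed.

Lemma ler_mean f g : (forall x, x \in A -> f x <= g x) -> mean A f <= mean A g.
Proof. by move=> h; rewrite /mean ler_pM2r ?invr_gt0 //; apply: ler_sum. Qed.

Lemma norm_mean_le f k : (forall x, x \in A -> `|f x| <= k) -> `|mean A f| <= k.
Proof.
move=> h; rewrite /mean normrM normfV [X in _ / X]gtr0_norm // ler_pdivrMr //.
apply: le_trans (ler_norm_sum _ _ _) _; rewrite mulr_natr -sumr_const.
exact: ler_sum.
Qed.

(** The variance on [A] is non-negative; the sum of squares is then enlarged from [A] to the whole
    type. *)
Lemma sqr_mean_le f : mean A f ^+ 2 <= (\sum_x f x ^+ 2) / #|A|%:R.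
Proof.
set m := mean A f.
have h : 0 <= mean A (fun x => (f x - m) ^+ 2).
  by rewrite -[leLHS](mean_cst 0); apply: ler_mean => x _; exact: sqr_ge0.
have e : mean A (fun x => (f x - m) ^+ 2) = mean A (fun x => f x ^+ 2) - m ^+ 2.
  rewrite /mean.
  rewrite (eq_bigr (fun x => f x ^+ 2 - (2 * m * f x - m ^+ 2))); last by move=> x _; ring.
  rewrite sumrB sumrB -mulr_sumr sumr_const -[_ *+ #|A|]mulr_natr.
  have -> : \sum_(a in A) f a = m * #|A|%:R by rewrite /m /mean mulfVK // gt_eqF.
  by field; rewrite gt_eqF.
rewrite e subr_ge0 in h; apply: le_trans h _.
rewrite /mean ler_pM2r ?invr_gt0 // [leRHS](bigID (fun x => x \in A)) /= lerDl.
by apply: sumr_ge0 => x _; exact: sqr_ge0.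
Qed.

End MeanOver.

Lemma mean_exchange (R : realType) (T T' : finType) (A : {set T}) (B : {set T'})
    (F : T -> T' -> R) :
  mean A (fun a => mean B (F a)) = mean B (fun b => mean A (F^~ b)).
Proof.
rewrite /mean -!mulr_suml exchange_big /= -!mulrA; congr (_ * _).
exact: mulrC.
Qed.

Section AlmostPeriodicity.
Variables (R : realType) (K : finFieldType) (n : nat).
Local Notation V := 'rV[K]_n.

Section DavgTranslate.
Variable T : {set V}.

Lemma davgE (f : V -> R) x :
  davg T f x = mean (finset.setX T T) (fun q => f (x + (q.1 - q.2))).
Proof. by rewrite /davg /mean cardsX natrM expr2. Qed.

(** [davg] commutes with translations and with averages. *)
Lemma iter_davg_mean_diff k (A : {set V}) (f : V -> R) :
  iter k (davg T) (fun x => mean A (fun w => f x - f (x + w))) =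
  fun x => mean A (fun w => iter k (davg T) f x - iter k (davg T) f (x + w)).
Proof.
elim: k => [//|k IH]; rewrite iterS IH; apply/funext => x.
rewrite davgE mean_exchange /=; congr (_ / _); apply: eq_bigr => w _.
rewrite meanB -davgE; congr (_ - _); rewrite davgE.
by congr (_ / _); apply: eq_bigr => q _; rewrite addrAC.
Qed.

End DavgTranslate.

Variables (B : {set V}) (f : V -> R).
Hypotheses (B0 : (0 < #|B|)%N) (f01 : forall x, 0 <= f x <= 1).

(** The convolution of [f] with the uniform measures on [B] and on [-B]. *)
Definition shifted_mean (x : V) : R := mean B (fun b => smooth B f (b + x)).

Lemma mean_close (g phi : V -> R) (dl : R) : 0 <= dl ->
  (forall y, 0 <= g y <= 1) -> (forall y, 0 <= phi y <= 1) ->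
  #|[set y | dl < `|g y - phi y|]|%:R <= dl * #|B|%:R ->
  forall x, `|mean B (fun b => g (b + x)) - mean B (fun b => phi (b + x))| <= 2 * dl.
Proof.
move=> dl0 g01 phi01 hbad x.
have b0 : 0 < #|B|%:R :> R by rewrite ltr0n.
rewrite -meanB /mean normrM normfV [X in _ / X]gtr0_norm // ler_pdivrMr //.
apply: le_trans (ler_norm_sum _ _ _) _.
apply: (@le_trans _ _ (\sum_(b in B) (dl + (dl < `|g (b + x) - phi (b + x)|)%R%:R))).
  apply: ler_sum => b _; case: ltP => h; last by rewrite addr0.
  have := g01 (b + x); have := phi01 (b + x) => /andP[? ?] /andP[? ?].
  by rewrite ler_norml /=; apply/andP; split; lra.
rewrite big_split /= sumr_const -[_ *+ #|B|]mulr_natr.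
have : \sum_(b in B) (dl < `|g (b + x) - phi (b + x)|)%R%:R <= dl * #|B|%:R.
  apply: le_trans hbad; rewrite natr_card_setE [leRHS](reindex_inj (addIr x)) /=.
  by rewrite [leRHS](bigID (fun b => b \in B)) /= lerDl; apply: sumr_ge0.
lra.
Qed.

(** Replacing [smooth B f] by its [k]-fold [davg] costs [4 * k%:R * dl], once at [0] and once in the
    mean over [W]. After that smoothing, the two quantities differ by at most [kap], because only
    frequencies outside the large spectrum of [T] remain in the difference. *)
Lemma almost_periodicity (dl kap : R) (k l : nat) :
  0 < dl -> dl <= 1 -> (0 < l)%N -> 0 <= kap ->
  4 * expR (- (dl ^+ 2 * l%:R / 8)) <= dl * (#|B|%:R / #|{: V}|%:R) ->
  (1 / 16) ^+ k <= kap ^+ 2 * (#|B|%:R / #|{: V}|%:R) ->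
  exists W : {vspace V},
    expR ((n - \dim W)%:R / 32) * (#|B|%:R / #|{: V}|%:R) ^+ l <= 2 :> R /\
    `|shifted_mean 0 - mean [set y | y \in W] shifted_mean| <= 8 * k%:R * dl + kap.
Proof.
move=> dl0 dl1 l0 kap0 hl hk.
have N0 : 0 < #|{: V}|%:R :> R by rewrite ltr0n; apply/card_gt0P; exists 0.
have b0 : 0 < #|B|%:R :> R by rewrite ltr0n.
have [T [phi [phi01 cardT perT]]] := exists_almost_periods B0 f01 l0 (ltW dl0) dl1 hl.
have T0 : (0 < #|T|)%N.
  rewrite -(ltr0n R); have : 0 < 2 * #|T|%:R :> R.
    by apply: lt_le_trans cardT; rewrite mulr_gt0 ?exprn_gt0 ?divr_gt0.
  lra.
have TT0 : (0 < #|finset.setX T T|)%N by rewrite cardsX muln_gt0 T0.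
have h01 := smooth01 B0 f01; pose h := smooth B f.
have close t x : t \in T -> `|shifted_mean (x - t) - mean B (fun b => phi (b + x))| <= 2 * dl.
  move=> tT; rewrite /shifted_mean.
  have := @mean_close (fun y => smooth B f (y - t)) phi dl (ltW dl0) _ phi01.
  have -> : mean B (fun b => smooth B f (b + (x - t))) = mean B (fun b => smooth B f (b + x - t)).
    by congr (_ / _); apply: eq_bigr => b _; rewrite addrA.
  apply=> [y|]; first exact: h01.
  by apply: le_trans (perT t tT) _; rewrite -mulrA mulfVK // gt_eqF.
(* Both almost periods are compared with the same function [phi], so it drops out. *)
have close2 t t' x : t \in T -> t' \in T ->
    `|shifted_mean (x + (t - t')) - shifted_mean x| <= 4 * dl.
  move=> tT tT'; have := close t (x + t) tT; have := close t' (x + t) tT'.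
  rewrite addrK -[x + t - t']addrA => h1 h2.
  have := ler_distD (mean B (fun b => phi (b + (x + t)))) (shifted_mean (x + (t - t'))) (shifted_mean x).
  by rewrite distrC in h2; lra.
have closek j x : `|mean B (fun b => iter j (davg T) h (b + x)) - shifted_mean x| <= 4 * j%:R * dl.
  elim: j x => [|j IH] x; first by rewrite subrr normr0 mulr0 mul0r.
  have -> : mean B (fun b => iter j.+1 (davg T) h (b + x)) =
     mean (finset.setX T T) (fun q => mean B (fun b => iter j (davg T) h (b + (x + (q.1 - q.2))))).
    rewrite mean_exchange; congr (_ / _); apply: eq_bigr => b _ /=.
    by rewrite davgE; congr (_ / _); apply: eq_bigr => q _; rewrite -[b + x + _]addrA.
  rewrite -[X in _ - X](mean_cst TT0) -meanB; apply: norm_mean_le => // -[t t'].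
  rewrite finset.in_setX /= => /andP[tT tT'].
  have := IH (x + (t - t')); have := close2 t t' x tT tT'; rewrite -[j.+1%:R]natr1.
  have := ler_distD (shifted_mean (x + (t - t')))
    (mean B (fun b => iter j (davg T) h (b + (x + (t - t'))))) (shifted_mean x).
  by move: (j%:R) => z; lra.
have [c [s [cs cs1]]] := exists_circle_hom R K.
have [L [iL specL annL]] : exists L : seq V, [/\ independent L,
    all (fun v => 1 / 4 < davg_eig c s T v) L &
    forall v x, 1 / 4 < davg_eig c s T v -> x \in annihilator L -> dot v x = 0].
  (* This crude length bound only ensures termination; the useful bound on [L] comes from applying
     [chang] again below. *)
  apply: (@exists_maximal_independent _ _ _ (Num.truncn (32 * #|{: V}|%:R : R))).
  move=> L iL specL; have hc := chang cs cs1 T0 iL specL.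
  rewrite truncn_ge_nat ?mulr_ge0 //.
  have hT : 1 <= #|T|%:R :> R by rewrite ler1n.
  have := expR_ge1Dx ((size L)%:R / 32 : R) => he.
  have : expR ((size L)%:R / 32) <= #|{: V}|%:R :> R.
    by apply: le_trans hc; rewrite ler_peMr ?expR_ge0.
  lra.
pose W := annihilator L; exists W; split.
  have hc := chang cs cs1 T0 iL specL.
  have : expR ((n - \dim W)%:R / 32) <= expR ((size L)%:R / 32) :> R.
    by rewrite ler_expR ler_pM2r ?invr_gt0 // ler_nat codim_annihilator.
  move=> hW; rewrite -(ler_pM2r N0) -mulrA.
  apply: le_trans (ler_wpM2r _ hW) _.
    by rewrite mulr_ge0 ?exprn_ge0 ?divr_ge0.
  apply: le_trans (ler_wpM2l (expR_ge0 _) cardT) _.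
  by rewrite mulrCA ler_pM2l.
pose A := [set y | y \in W].
have A0 : (0 < #|A|)%N by apply/card_gt0P; exists 0; rewrite inE mem0v.
pose g := fun x => mean A (fun w => h x - h (x + w)).
have gE : mean B (iter k (davg T) g) = mean B (fun b => iter k (davg T) h (b + 0)) -
    mean A (fun w => mean B (fun b => iter k (davg T) h (b + w))).
  rewrite /g iter_davg_mean_diff [LHS]mean_exchange.
  rewrite -[mean B (fun b => iter k (davg T) h (b + 0))](mean_cst A0) -meanB.
  congr (_ / _); apply: eq_bigr => w _; rewrite -meanB.
  by congr (_ / _); apply: eq_bigr => b _; rewrite addr0.
have gk : `|mean B (iter k (davg T) g)| <= kap.
  rewrite -(@ler_pXn2r _ 2) ?nnegrE // real_normK ?num_real //.
  apply: le_trans (sqr_mean_le B0 _) _.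
  (* Frequencies in the large spectrum vanish on [W], so translation by [w] in [W] does not change
     those coefficients of [h]. *)
  have gspec v : 1 / 4 < davg_eig c s T v -> fcos c g v = 0 /\ fsin s g v = 0.
    move=> hv.
    have dv w : w \in A -> dot v w = 0 by rewrite inE; exact: annL.
    split.
      rewrite /g /mean (fcos_sum c (fun w => w \in A) (fun w x => h x - h (x + w))) big1 ?mul0r // => w wA.
      transitivity (fcos c h v - fcos c (fun x => h (x + w)) v).
        by rewrite /fcos -sumrB; apply: eq_bigr => x _; rewrite mulrBl.
      by rewrite (fcos_translate cs) dv // (circle_cos0 cs) (circle_sin0 cs); ring.
    rewrite /g /mean (fsin_sum s (fun w => w \in A) (fun w x => h x - h (x + w))) big1 ?mul0r // => w wA.
    transitivity (fsin s h v - fsin s (fun x => h (x + w)) v).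
      by rewrite /fsin -sumrB; apply: eq_bigr => x _; rewrite mulrBl.
    by rewrite (fsin_translate cs) dv // (circle_cos0 cs) (circle_sin0 cs); ring.
  have := iter_davg_l2 cs cs1 k gspec => hg.
  have g1 : \sum_x g x ^+ 2 <= #|{: V}|%:R.
    rewrite -sumr_const; apply: ler_sum => x _.
    rewrite -[leLHS]real_normK ?num_real // exprn_ile1 //.
    apply: norm_mean_le => // w _; have := h01 x; have := h01 (x + w).
    by rewrite ler_norml /h => /andP[? ?] /andP[? ?]; apply/andP; split; lra.
  rewrite ler_pdivrMr //; apply: le_trans hg _.
  apply: le_trans (ler_wpM2l _ g1) _; first by rewrite exprn_ge0.
  have := ler_wpM2r (ltW N0) hk.
  by rewrite -[X in _ <= X]mulrA mulfVK // gt_eqF.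
have h1 := closek k 0.
have h2 : `|mean A (fun w => mean B (fun b => iter k (davg T) h (b + w))) -
    mean A shifted_mean| <= 4 * k%:R * dl.
  by rewrite -meanB; apply: norm_mean_le.
move: h1 h2 gk; rewrite gE.
move: (mean B _) (mean A (fun w => _)) (mean A shifted_mean) (shifted_mean 0) => x y z w.
rewrite distrC => h1 h2 h3.
have := ler_distD x w z; have := ler_distD y x z; lra.
Qed.

End AlmostPeriodicity.

(** * Choice of parameters for almost periodicity *)

Section Quantitative.
Variable R : realType.

Lemma expR1_le4 : expR 1 <= 4 :> R.
Proof.
have h : expR (1 / 2) <= 2 :> R.
  by apply: le_trans (expR_le_quadratic _) _; lra.
have -> : 1 = 1 / 2 + 1 / 2 :> R by lra.
rewrite expRD; have := expR_ge0 (1 / 2 : R); nra.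
Qed.

(** Take [dl = x^-1] with [x = 16 * k / th] and [kap = th / 2], so that the error [8 * k * dl + kap]
    equals [th]. With [k] of order [Lam] and [l] of order [x ^+ 3], the codimension is [O(l * Lam)],
    that is [O(Lam ^+ 4)] for fixed [th]. *)
Lemma almost_periodicity_exp (th : R) : 0 < th -> th < 1 ->
  forall (K : finFieldType) (n : nat) (B : {set 'rV[K]_n}) (f : 'rV[K]_n -> R) (Lam : R),
  1 <= Lam -> (0 < #|B|)%N -> (forall x, 0 <= f x <= 1) ->
  expR (- Lam) <= #|B|%:R / #|{: 'rV[K]_n}|%:R ->
  exists W : {vspace 'rV[K]_n},
    (n - \dim W)%:R <= 64 * 41 * 48 ^+ 3 / th ^+ 6 * Lam ^+ 4 /\
    `|shifted_mean B f 0 - mean [set y | y \in W] (shifted_mean B f)| <= th.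
Proof.
move=> th0 th1 K n B f Lam L1 B0 f01; set bt := _ / _ => hbt.
have bt0 : 0 < bt by apply: lt_le_trans hbt; exact: expR_gt0.
have ltL : 1 <= Lam / th by rewrite ler_pdivlMr //; lra.
(* Large enough that one factor [(1 / 4) ^+ k] is below [(th / 2) ^+ 2] and another is below
   [expR (- Lam)]. *)
pose k := (Num.truncn (2 * (Lam / th))).+1.
have k1 : 2 * (Lam / th) <= k%:R by apply/ltW/truncnS_gt.
have k2 : k%:R <= 3 * (Lam / th).
  have : (Num.truncn (2 * (Lam / th)))%:R <= 2 * (Lam / th) by rewrite truncn_le; lra.
  by rewrite /k -[(Num.truncn _).+1%:R]natr1; lra.
have k0 : 0 < k%:R :> R by rewrite ltr0n.
pose x := 16 * k%:R / th.
have x0 : 0 < x by rewrite divr_gt0 // mulr_gt0.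
have x1 : 1 <= x by rewrite ler_pdivlMr //; lra.
have xL : Lam <= x.
  rewrite ler_pdivlMr //; apply: (@le_trans _ _ Lam); first by rewrite ler_piMr; lra.
  have : Lam <= Lam / th by rewrite ler_pdivlMr // ler_piMr; lra.
  lra.
have x2 : x <= 48 * Lam / th ^+ 2.
  have -> : 48 * Lam / th ^+ 2 = 16 * (3 * (Lam / th)) / th by field; rewrite gt_eqF.
  by rewrite /x ler_pM2r ?invr_gt0 // ler_pM2l.
(* This makes the tail exponent at least [4 * x + Lam]: the part [4 * x] pays for [dl = x^-1] and
   the constant [4], the part [Lam] for the density of [B]. *)
pose l := (Num.truncn (8 * x ^+ 2 * (4 * x + Lam))).+1.
have y0 : 0 <= 8 * x ^+ 2 * (4 * x + Lam).
  by apply: mulr_ge0; [apply: mulr_ge0 => //; exact: sqr_ge0 | lra].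
have l1 : 8 * x ^+ 2 * (4 * x + Lam) <= l%:R by apply/ltW/truncnS_gt.
have l2 : l%:R <= 41 * x ^+ 3.
  have : (Num.truncn (8 * x ^+ 2 * (4 * x + Lam)))%:R <= 8 * x ^+ 2 * (4 * x + Lam).
    by rewrite truncn_le.
  rewrite /l -[(Num.truncn _).+1%:R]natr1.
  have : 8 * x ^+ 2 * (4 * x + Lam) <= 8 * x ^+ 2 * (5 * x).
    apply: ler_wpM2l; last lra.
    by apply: mulr_ge0 => //; exact: sqr_ge0.
  have : 1 <= x ^+ 3 by exact: exprn_ege1.
  have -> : 8 * x ^+ 2 * (5 * x) = 40 * x ^+ 3 by ring.
  by move: (8 * x ^+ 2 * _) => z; lra.
have [||||||W [hW1 hW2]] := @almost_periodicity R K n B f B0 f01 x^-1 (th / 2) k l.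
- by rewrite invr_gt0.
- by rewrite invf_le1.
- by [].
- lra.
- rewrite -/bt.
  apply: (@le_trans _ _ (4 * expR (- (4 * x) - Lam))).
    rewrite ler_pM2l // ler_expR -opprD lerN2.
    have -> : 4 * x + Lam = x^-1 ^+ 2 * (8 * x ^+ 2 * (4 * x + Lam)) / 8.
      by field; rewrite gt_eqF.
    rewrite ler_pM2r ?invr_gt0 // ler_wpM2l // sqr_ge0 //.
  rewrite expRD mulrA; apply: ler_pM => //; rewrite ?mulr_ge0 ?expR_ge0 //.
  rewrite expRN.
  have h4 : 4 * x <= expR (4 * x) by apply: le_trans (expR_ge1Dx _); lra.
  rewrite ler_pdivrMr ?expR_gt0 //.
  by rewrite mulrC ler_pdivlMr.
- rewrite -/bt.
  have -> : (1 / 16 : R) ^+ k = (1 / 4) ^+ k * (1 / 4) ^+ k.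
    by rewrite -exprMn; congr (_ ^+ _); lra.
  apply: ler_pM; rewrite ?exprn_ge0 //.
    have -> : (1 / 4 : R) ^+ k = ((1 / 2) ^+ k) ^+ 2.
      by rewrite -exprM mulnC exprM; congr (_ ^+ _); lra.
    apply: lerXn2r; rewrite ?nnegrE ?exprn_ge0 //; first lra.
    rewrite div1r exprVn -[th / 2]invrK lef_pV2 ?posrE ?exprn_gt0 ?invr_gt0 ?divr_gt0 //.
    apply: (@le_trans _ _ k%:R).
      rewrite invf_div; apply: le_trans k1; by rewrite ler_pM2l // -[leLHS]mul1r ler_pM2r ?invr_gt0.
    by rewrite -natrX ler_nat ltnW // ltn_expl.
  apply: le_trans hbt.
  apply: (@le_trans _ _ (expR (- k%:R))).
    rewrite expRN -[k%:R]mulr1 expRM_natl div1r exprVn lef_pV2 ?posrE ?exprn_gt0 ?expR_gt0 //.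
    by apply: lerXn2r; rewrite ?nnegrE ?expR_ge0 //; exact: expR1_le4.
  rewrite ler_expR lerN2; apply: le_trans k1.
  have : Lam <= Lam / th by rewrite ler_pdivlMr // ler_piMr; lra.
  lra.
exists W; split; last first.
  apply: le_trans hW2 _; rewrite /x le_eqVlt; apply/orP; left; apply/eqP; field.
  by rewrite !gt_eqF.
rewrite -/bt in hW1.
have h1 : expR ((n - \dim W)%:R / 32) <= expR (1 + l%:R * Lam).
  have h2 : expR ((n - \dim W)%:R / 32) * expR (- Lam) ^+ l <= 2.
    apply: le_trans hW1; apply: ler_wpM2l; first exact: expR_ge0.
    by apply: lerXn2r => //; rewrite nnegrE; [exact: expR_ge0 | exact: ltW].
  rewrite expRN exprVn -expRM_natl ler_pdivrMr ?expR_gt0 // in h2.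
  apply: le_trans h2 _; rewrite expRD ler_pM2r ?expR_gt0 //.
  by apply: le_trans (expR_ge1Dx 1); lra.
rewrite ler_expR ler_pdivrMr // in h1.
apply: le_trans h1 _.
apply: (@le_trans _ _ (64 * (l%:R * Lam))).
  have l1' : 1 <= l%:R :> R by rewrite ler1n.
  have : 1 <= l%:R * Lam by rewrite -[leLHS]mulr1; apply: ler_pM.
  lra.
have x3 : x ^+ 3 <= (48 * Lam / th ^+ 2) ^+ 3.
  by apply: lerXn2r => //; rewrite nnegrE; [exact: ltW | apply: le_trans x2; exact: ltW].
apply: (@le_trans _ _ (64 * (41 * (48 * Lam / th ^+ 2) ^+ 3 * Lam))).
  rewrite ler_pM2l //; apply: ler_wpM2r; first lra.
  by apply: le_trans l2 _; rewrite ler_pM2l.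
by rewrite le_eqVlt; apply/orP; left; apply/eqP; field; rewrite gt_eqF.
Qed.

End Quantitative.

(** * The family A_g *)

Lemma ex_mean_le (R : realType) (T : finType) (A : {set T}) (f : T -> R) (k : R) :
  (0 < #|A|)%N -> k <= mean A f -> exists2 x, x \in A & k <= f x.
Proof.
move=> A0 h; have a0 : 0 < #|A|%:R :> R by rewrite ltr0n.
apply: contrapT => H.
have {}H x : x \in A -> f x < k.
  by move=> xA; rewrite ltNge; apply/negP => hx; apply: H; exists x.
suff : \sum_(x in A) f x < \sum_(x in A) k.
  rewrite sumr_const -[_ *+ #|A|]mulr_natr ltNge -ler_pdivlMr //.
  by rewrite -/(mean A f) h.
apply: ltr_sum => [|x xA]; last exact: H.
by have /card_gt0P[x xA] := A0; apply/hasP; exists x; rewrite ?mem_index_enum.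
Qed.

Section Family.
Variables (R : realType) (K : finFieldType) (n : nat).
Local Notation V := 'rV[K]_n.
Variable A : V -> {set V}.
Local Notation N := (#|{: V}|%:R : R).
Local Notation a g := (#|A g|%:R : R).

Let N0 : 0 < N. Proof. by rewrite ltr0n; apply/card_gt0P; exists 0. Qed.

(** The mean over [x] of the pair counts summed over [g], whatever the shifts; hence the common
    normaliser of [mu_F] and [mu_F']. *)
Definition energy : R := (\sum_g a g ^+ 2) / N.
Definition balanced (g : V) : V -> R := fun y => (y \in A g)%:R - a g / N.
Definition pair_count (g x : V) : R := \sum_y (y \in A g)%:R * (x + y \in A g)%:R.

Lemma sum_mem g : \sum_y (y \in A g)%:R = a g.
Proof. by rewrite -natr_card_setE; congr (_%:R); apply: eq_card => y; rewrite inE. Qed.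

Lemma sum_memD g x : \sum_y (x + y \in A g)%:R = a g.
Proof.
rewrite -(sum_mem g) [RHS](reindex_inj (addrI x)).
by apply: eq_bigr.
Qed.

(** Subtracting the density removes exactly the mean of the pair count. This is what turns
    [mu_F - 1] and [mu_F' - 1] into pure sums of autocorrelations. *)
Lemma autocorr_balanced g x : autocorr (balanced g) x = pair_count g x - a g ^+ 2 / N.
Proof.
rewrite /autocorr /balanced /pair_count.
rewrite (eq_bigr (fun y => (y \in A g)%:R * (x + y \in A g)%:R -
  (a g / N * (y \in A g)%:R + a g / N * (x + y \in A g)%:R - (a g / N) ^+ 2))); last first.
  by move=> y _; ring.
rewrite sumrB sumrB big_split /= -!mulr_sumr sum_mem sum_memD sumr_const.
rewrite -[_ *+ #|_|]mulr_natr; congr (_ - _); field; by rewrite gt_eqF.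
Qed.

Lemma sum_autocorr_balanced (sh : V -> V) x :
  \sum_g autocorr (balanced g) (x - sh g) = \sum_g pair_count g (x - sh g) - energy.
Proof.
rewrite (eq_bigr (fun g => pair_count g (x - sh g) - a g ^+ 2 / N)).
  by rewrite sumrB -mulr_suml.
by move=> g _; rewrite autocorr_balanced.
Qed.

Lemma sum_pair_count (sh : V -> V) :
  \sum_x \sum_g pair_count g (x - sh g) = N * energy.
Proof.
rewrite exchange_big /= /energy mulrC mulfVK ?gt_eqF //; apply: eq_bigr => g _.
rewrite exchange_big /= expr2 -{1}(sum_mem g) mulr_suml; apply: eq_bigr => y _.
rewrite -mulr_sumr; congr (_ * _); rewrite -(sum_memD g (y - sh g)).
by apply: eq_bigr => x _; rewrite addrC addrA addrAC.
Qed.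

Let F : V -> R := fun x => \sum_g corr (ind R (A g)) (ind R (translate (A g) g)) x.
Let F' : V -> R := fun x => \sum_g corr (ind R (A g)) (ind R (A g)) x.

Lemma corr_translateE x : F x = (\sum_g pair_count g (x - g)) / N.
Proof.
rewrite /F /corr /avg mulr_suml; apply: eq_bigr => g _; congr (_ / _).
apply: eq_bigr => y _; rewrite /ind; congr (_ * _%:R).
have -> : (x + y \in translate (A g) g) = (x - g + y \in A g) by
  rewrite -(mem_imset (A g) _ (addIr g)) addrAC subrK.
by [].
Qed.

Lemma corrE x : F' x = diffcount R A x / N.
Proof.
by rewrite /F' /corr /avg /diffcount mulr_suml.
Qed.

Lemma diffcountE x : diffcount R A x = \sum_g pair_count g (x - 0).
Proof. by rewrite subr0. Qed.

Lemma mu_corr_translateE x : mu_of F x = (\sum_g pair_count g (x - g)) / energy.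
Proof.
rewrite /mu_of /avg; under [X in _ / (X / _)]eq_bigr => y _ do rewrite corr_translateE.
rewrite -mulr_suml (sum_pair_count id) corr_translateE.
have -> : N * energy / N / N = energy / N by field; rewrite gt_eqF.
by rewrite invf_div mulrA mulfVK ?gt_eqF.
Qed.

Lemma mu_corrE x : mu_of F' x = diffcount R A x / energy.
Proof.
rewrite /mu_of /avg; under [X in _ / (X / _)]eq_bigr => y _ do rewrite corrE diffcountE.
rewrite -mulr_suml (sum_pair_count (fun=> 0)) corrE.
have -> : N * energy / N / N = energy / N by field; rewrite gt_eqF.
by rewrite invf_div mulrA mulfVK ?gt_eqF.
Qed.

Lemma energy_ge (t : R) : 0 <= t -> t * N ^+ 2 <= \sum_g a g -> t ^+ 2 * N ^+ 2 <= energy.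
Proof.
move=> t0 h.
have T0 : (0 < #|[set: V]|)%N by rewrite cardsT; apply/card_gt0P; exists 0.
have := sqr_mean_le T0 (fun g => a g); rewrite /mean cardsT -/energy.
apply: le_trans; rewrite -exprMn; apply: lerXn2r; rewrite ?nnegrE.
- by rewrite mulr_ge0.
- by rewrite divr_ge0 //; apply: sumr_ge0.
- rewrite ler_pdivlMr // -mulrA -expr2; apply: le_trans h _.
  by rewrite le_eqVlt; apply/orP; left; apply/eqP; apply: eq_bigl => g; rewrite inE.
Qed.

Hypothesis E0 : 0 < energy.

Lemma mu_sub1_shift x : mu_of F x - 1 = (\sum_g autocorr (balanced g) (x - g)) / energy.
Proof. by rewrite mu_corr_translateE (sum_autocorr_balanced id) mulrBl divff ?gt_eqF. Qed.

Lemma mu_sub1 x : mu_of F' x - 1 = (\sum_g autocorr (balanced g) x) / energy.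
Proof.
have := sum_autocorr_balanced (fun=> 0) x; rewrite -diffcountE.
under eq_bigr => g _ do rewrite subr0.
by move=> ->; rewrite mu_corrE mulrBl divff ?gt_eqF.
Qed.

Lemma moment_mu_le p :
  \sum_x (mu_of F x - 1) ^+ p <= \sum_x (mu_of F' x - 1) ^+ p.
Proof.
under eq_bigr => x _ do rewrite mu_sub1_shift expr_div_n.
under [leRHS]eq_bigr => x _ do rewrite mu_sub1 expr_div_n.
rewrite -!mulr_suml ler_pM2r ?invr_gt0 ?exprn_gt0 //.
apply: le_trans (ler_norm _) _; exact: (moment_shift_le balanced id).
Qed.

Lemma moment_mu_ge0 p : 0 <= \sum_x (mu_of F' x - 1) ^+ p.
Proof.
under eq_bigr => x _ do rewrite mu_sub1 expr_div_n.
rewrite -mulr_suml; apply: divr_ge0; first exact: moment_ge0.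
by rewrite exprn_ge0 // ltW.
Qed.

(** The weights [w] proportional to [#|A x|] are a probability measure under which [mu_F - 1] has
    mean above [eps] in absolute value. Power means raise this to the exponent [2 * m], and
    [w x <= 1 / (t * N)] compares [w] with the uniform measure. *)
Lemma moment_lower_bound (eps t : R) m : 0 < eps -> 0 < t -> (0 < m)%N ->
  t * N ^+ 2 <= \sum_g a g ->
  eps < `|inner (mu_of F) (mu_of (fun x => a x)) - 1| ->
  t * eps ^+ (2 * m) * N <= \sum_x (mu_of F x - 1) ^+ (2 * m).
Proof.
move=> eps0 t0 m0 ht hin.
pose s := \sum_g a g.
have s0 : 0 < s by apply: lt_le_trans ht; rewrite mulr_gt0 // exprn_gt0.
pose w x := a x / s.
have w0 x : 0 <= w x by rewrite divr_ge0 // ltW.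
have w1 : \sum_x w x = 1 by rewrite -mulr_suml divff // gt_eqF.
have wt x : w x * (t * N) <= 1.
  rewrite /w mulrAC ler_pdivrMr // mul1r; apply: le_trans ht.
  rewrite mulrCA ler_pM2l // expr2 ler_pM2r // ler_nat; exact: max_card.
have E : inner (mu_of F) (mu_of (fun x => a x)) - 1 = \sum_x w x * (mu_of F x - 1).
  rewrite -[X in _ - X]w1 /inner /avg mulr_suml -sumrB; apply: eq_bigr => x _.
  have -> : mu_of (fun x => a x) x = w x * N.
    by rewrite /mu_of /avg invf_div mulrA mulrAC.
  by rewrite mulrA mulfK ?gt_eqF // mulrBr mulr1 mulrC.
have h1 : eps <= \sum_x w x * `|mu_of F x - 1|.
  apply: ltW; apply: lt_le_trans hin _; rewrite E.
  apply: le_trans (ler_norm_sum _ _ _) _.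
  by apply: ler_sum => x _; rewrite normrM ger0_norm.
have [p pE] : exists p, (2 * m = p.+1)%N by case: m m0 => // m _; exists (2 * m).+1; rewrite mulnS.
have h2 := @power_mean R V w (fun x => `|mu_of F x - 1|) p w0 (fun x => normr_ge0 _) w1.
have h3 : eps ^+ (2 * m) <= \sum_x w x * (mu_of F x - 1) ^+ (2 * m).
  apply: (@le_trans _ _ (\sum_x w x * `|mu_of F x - 1| ^+ (2 * m))).
    rewrite pE; apply: le_trans h2; apply: lerXn2r => //; rewrite nnegrE.
      exact: ltW.
    by apply: le_trans h1; exact: ltW.
  apply: ler_sum => x _.
  by rewrite exprM real_normK ?num_real // -exprM.
apply: (@le_trans _ _ (t * N * \sum_x w x * (mu_of F x - 1) ^+ (2 * m))).
  rewrite mulrAC ler_pM2l ?mulr_gt0 //.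
rewrite mulr_sumr; apply: ler_sum => x _.
rewrite mulrA mulrC ler_piMr //; last by rewrite mulrC.
by rewrite exprM exprn_ge0 // sqr_ge0.
Qed.

End Family.

(** * Concentration of high moments and the structured set *)

Section Final.
Variable R : realType.

(** In the induction step, [(1 + x) * (1 - M.+1%:R * x)] is at most [1 - M%:R * x]. *)
Lemma exprn_1D_mul_le1 (x : R) M : 0 <= x -> (1 + x) ^+ M * (1 - M%:R * x) <= 1.
Proof.
move=> x0; elim: M => [|M IH]; first by rewrite expr0; lra.
apply: le_trans IH; rewrite exprSr -mulrA; apply: ler_wpM2l.
  by rewrite exprn_ge0 //; lra.
rewrite -[M.+1%:R]natr1; have : 0 <= M%:R :> R by [].
by move: (M%:R) => z z0; have := mulr_ge0 z0 (sqr_ge0 x); have := sqr_ge0 x; nra.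
Qed.

Lemma expRN_le_pow2 (d : R) : 0 <= d -> expR (- d) <= 2 `^ (- d).
Proof.
move=> d0.
rewrite /powR gt_eqF // ler_expR mulNr lerN2; apply: ler_piMr; first lra.
have -> : 2 = 1 + 1 :> R by lra.
by apply: le_ln1Dx; lra.
Qed.

Lemma pow2_mul_ge1 (d : R) m : d <= m%:R -> 1 <= 2 `^ (- d) * 2 ^+ m.
Proof.
move=> h; rewrite -powR_mulrn // -powRD; last by apply/implyP => _; rewrite gt_eqF.
rewrite -[leLHS](powRr0 2); apply: ler_powR; lra.
Qed.

Section Family.
Variables (K : finFieldType) (n : nat).
Local Notation V := 'rV[K]_n.
Variable A : V -> {set V}.
Local Notation N := (#|{: V}|%:R : R).
Local Notation mu := (fun x : V => diffcount R A x / energy R A).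

Let N0 : 0 < N. Proof. by rewrite ltr0n; apply/card_gt0P; exists 0. Qed.

Lemma diffcount_ge0 x : 0 <= diffcount R A x.
Proof. by apply: sumr_ge0 => g _; apply: sumr_ge0 => y _; rewrite mulr_ge0. Qed.

(** With [P = M * (2 * m)], one binomial term gives a total moment of at least [16 ^+ m * t * N].
    Outside [S], [(1 + eps / 8) ^+ M <= 8 / 3] gives at most [(64 / 9) ^+ m * N]. So [S] carries
    almost all of the moment and sifting applies. *)
Lemma exists_structured_set (eps th t : R) (M m : nat) :
  0 < eps -> 0 < th -> 0 < t -> 4 <= M%:R * eps -> M%:R * (eps / 8) <= 5 / 8 ->
  1 <= t * 2 ^+ m -> 1 <= th * (9 / 8) ^+ m -> 0 < energy R A ->
  t ^+ 2 * N ^+ 2 <= energy R A ->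
  t * eps ^+ (2 * m) * N <= \sum_x (mu x - 1) ^+ (2 * m) ->
  (forall j, 0 <= \sum_x (mu x - 1) ^+ j) ->
  exists B : {set V},
    t ^+ (2 * (M * (2 * m))) <= 2 * (#|B|%:R / N) ^+ 2 /\
    \sum_(a in B) \sum_(b in B) (~~ (1 + eps / 8 <= mu (b - a)))%:R <=
      2 * th * #|B|%:R ^+ 2.
Proof.
move=> eps0 th0 t0 M1 M2 tm thm E0 hE hmom hpos.
have M0 : (0 < M)%N by rewrite lt0n; apply/eqP => M0; move: M1; rewrite M0 mul0r; lra.
set P := (M * (2 * m))%N.
have mu0 x : 0 <= mu x by rewrite divr_ge0 ?diffcount_ge0 // ltW.
pose S := [set x : V | 1 + eps / 8 <= mu x].
(* The gain [16 / (64 / 9) = 9 / 4] is split so that [2 ^+ m] absorbs [t] and [(9 / 8) ^+ m] absorbs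
   [th]. *)
have e16 : (16 : R) ^+ m = (64 / 9) ^+ m * ((9 / 8) ^+ m * 2 ^+ m).
  by rewrite -!exprMn; congr (_ ^+ _); lra.
have big : 16 ^+ m * t * N <= \sum_x mu x ^+ P.
  apply: (@le_trans _ _ ('C(P, 2 * m)%:R * \sum_x (mu x - 1) ^+ (2 * m))); last first.
    rewrite [leRHS](eq_bigr (fun x => (1 + (mu x - 1)) ^+ P)); last by move=> x _; rewrite subrKC.
    by apply: (sum_expn_ge0_binomial (f := fun x => mu x - 1)); rewrite /P ?leq_pmull.
  apply: (@le_trans _ _ (M%:R ^+ (2 * m) * (t * eps ^+ (2 * m) * N))); last first.
    apply: ler_pM => //; rewrite ?exprn_ge0 //.
      by rewrite !mulr_ge0 ?exprn_ge0 // ltW.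
    by rewrite -natrX ler_nat expn_le_bin.
  have -> : M%:R ^+ (2 * m) * (t * eps ^+ (2 * m) * N) = (M%:R * eps) ^+ (2 * m) * t * N.
    by rewrite exprMn; move: (M%:R ^+ _) (eps ^+ _) => u v; ring.
  apply: ler_wpM2r => //; apply: ler_wpM2r; first exact: ltW.
  rewrite exprM; apply: lerXn2r; rewrite ?nnegrE ?sqr_ge0 //; nra.
have small : \sum_(x in ~: S) mu x ^+ P <= (64 / 9) ^+ m * N.
  apply: (@le_trans _ _ (\sum_(x : V) (64 / 9) ^+ m)); last first.
    by rewrite sumr_const -[leLHS]mulr_natr.
  rewrite big_mkcond /=; apply: ler_sum => x _.
  case: ifP => [|_]; last by rewrite exprn_ge0 //; lra.
  rewrite !inE -ltNge => hx.
  have h1 : (1 + eps / 8) ^+ M <= 8 / 3.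
    have := @exprn_1D_mul_le1 (eps / 8) M.
    have : 0 <= (1 + eps / 8) ^+ M by rewrite exprn_ge0 //; lra.
    move: ((1 + eps / 8) ^+ M) (M%:R * (eps / 8)) M2 => u v hv u0 h.
    have := h ltac:(lra); nra.
  have h2 : mu x ^+ M <= 8 / 3.
    apply: le_trans h1; by apply: lerXn2r; rewrite ?nnegrE; [exact: mu0 | rewrite addr_ge0 // divr_ge0 // ltW | exact: ltW].
  rewrite /P exprM exprM; apply: lerXn2r; rewrite ?nnegrE ?sqr_ge0 ?divr_ge0 //.
  have : 0 <= mu x ^+ M by rewrite exprn_ge0.
  by move: (mu x ^+ M) h2 => u; nra.
have ratio : \sum_(x in ~: S) mu x ^+ P <= th * \sum_x mu x ^+ P.
  apply: le_trans small _; apply: le_trans (ler_wpM2l (ltW th0) big).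
  rewrite !mulrA; apply: ler_wpM2r => //.
  rewrite e16; apply: (@le_trans _ _ ((64 / 9) ^+ m * ((th * (9 / 8) ^+ m) * (t * 2 ^+ m)))).
    rewrite ler_peMr ?exprn_ge0 ?divr_ge0 //.
    by rewrite -[leLHS]mulr1; apply: ler_pM.
  by move: (_ ^+ m) (_ ^+ m) (_ ^+ m) => u v w; rewrite le_eqVlt; apply/orP; left; apply/eqP; ring.
have dE x : diffcount R A x ^+ P = energy R A ^+ P * mu x ^+ P.
  by rewrite -exprMn mulrC mulfVK // gt_eqF.
have EP : 0 < energy R A ^+ P by rewrite exprn_gt0.
have one : 1 <= 16 ^+ m * t.
  apply: le_trans tm _; rewrite mulrC; apply: ler_wpM2r; first exact: ltW.
  by apply: lerXn2r; rewrite ?nnegrE //; lra.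
have sum0 : N <= \sum_x mu x ^+ P.
  by apply: le_trans big; rewrite ler_peMl.
have [||B [hB1 hB2]] := @exists_sift R V A P S th th0.
- under eq_bigr => x _ do rewrite dE.
  under [X in _ * X]eq_bigr => x _ do rewrite dE.
  by rewrite -!mulr_sumr mulrCA ler_pM2l.
- under eq_bigr => x _ do rewrite dE.
  by rewrite -mulr_sumr mulr_gt0 //; apply: lt_le_trans sum0.
exists B; split; last first.
  apply: le_trans hB2; apply: ler_sum => a _; apply: ler_sum => b _.
  by rewrite inE.
move: hB1; under eq_bigr => x _ do rewrite dE.
rewrite -mulr_sumr => hB1.
have h : (t ^+ 2 * N ^+ 2) ^+ P * N <= energy R A ^+ P * \sum_x mu x ^+ P.
  have tN : 0 <= t ^+ 2 * N ^+ 2 by apply: mulr_ge0; exact: sqr_ge0.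
  apply: ler_pM => //; first exact: exprn_ge0.
  by apply: lerXn2r => //; rewrite nnegrE // ltW.
have := le_trans h hB1; rewrite exprMn -!exprM => h3.
have NP : 0 < N ^+ (2 * P) by rewrite exprn_gt0.
rewrite -(ler_pM2r (mulr_gt0 NP N0)).
apply: (@le_trans _ _ (t ^+ (2 * P) * N ^+ (2 * P) * N)); first by rewrite mulrA.
apply: le_trans h3 _; rewrite le_eqVlt; apply/orP; left; apply/eqP.
move: (N ^+ (2 * P)) => u; field; by rewrite gt_eqF.
Qed.

End Family.
End Final.

(** * From averaged densities to a single coset *)

Section Subspace.
Variables (R : realType) (K : finFieldType) (n : nat).
Local Notation V := 'rV[K]_n.

Lemma convol_mu_subE (f : V -> R) (W : {vspace V}) x :
  convol f (mu_sub R W) x = mean [set y | y \in W] (fun w => f (x + w)).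
Proof.
have N0 : 0 < #|{: V}|%:R :> R by rewrite ltr0n; apply/card_gt0P; exists 0.
have W0 : 0 < #|[set y : V | y \in W]|%:R :> R.
  by rewrite ltr0n; apply/card_gt0P; exists 0; rewrite inE mem0v.
rewrite /convol /avg /mean (reindex_inj (addrI x)) /= [in RHS]big_mkcond /= !mulr_suml.
apply: eq_bigr => w _; rewrite /mu_sub opprD addrA subrr add0r memvN inE.
case: (w \in W); last by rewrite !mulr0 !mul0r.
by rewrite mulr1 mulrCA mulrC mulKf // gt_eqF.
Qed.

Lemma le_supnorm (f : V -> R) x : `|f x| <= supnorm f.
Proof. exact: (le_bigmax _ (fun x => `|f x|)). Qed.

(** The hypothesis averages the density of [S] on the cosets of [b' - b] over pairs from [B]; some
    pair reaches the average. *)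
Lemma exists_dense_coset (B : {set V}) (S : pred V) (W : {vspace V}) (k : R) :
  (0 < #|B|)%N ->
  k <= mean [set y | y \in W] (shifted_mean B (fun x => (S x)%:R)) ->
  exists x, k <= mean [set y | y \in W] (fun w => (S (x + w))%:R).
Proof.
move=> B0 h.
have [|b' _ hb'] := @ex_mean_le R V B
  (fun b' => mean [set y | y \in W] (fun w => smooth B (fun x => (S x)%:R) (b' + w))) k B0.
  by rewrite mean_exchange.
have [|b _ hb] := @ex_mean_le R V B
  (fun b => mean [set y | y \in W] (fun w => (S (b' + w - b))%:R)) k B0.
  by rewrite mean_exchange.
exists (b' - b); apply: le_trans hb _.
rewrite le_eqVlt; apply/orP; left; apply/eqP.
by congr (_ / _); apply: eq_bigr => w _; rewrite addrAC.
Qed.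

Lemma shifted_mean0_ge (B : {set V}) (S : pred V) (k : R) : (0 < #|B|)%N ->
  \sum_(a in B) \sum_(b in B) (~~ S (b - a))%:R <= k * #|B|%:R ^+ 2 ->
  1 - k <= shifted_mean B (fun x => (S x)%:R) 0.
Proof.
move=> B0 h; have b0 : 0 < #|B|%:R :> R by rewrite ltr0n.
have -> : shifted_mean B (fun x => (S x)%:R) 0 =
    (\sum_(a in B) \sum_(b in B) (1 - (~~ S (b - a))%:R)) / #|B|%:R ^+ 2 :> R.
  rewrite exchange_big /= /shifted_mean /mean /smooth -mulr_suml expr2 invfM mulrA.
  congr (_ / _ / _); apply: eq_bigr => b _; apply: eq_bigr => a _.
  by rewrite addr0; case: (S _); rewrite ?subr0 ?subrr.
rewrite ler_pdivlMr ?exprn_gt0 // mulrBl mul1r.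
under [leRHS]eq_bigr => a _ do rewrite sumrB sumr_const.
by rewrite sumrB sumr_const -[X in _ <= X - _]mulr_natr -expr2 lerD2l lerN2.
Qed.

End Subspace.

Theorem theorem3p2 (R : realType) (eps : R) (heps0 : 0 < eps) (heps1 : eps < 1) :
  exists C : R, forall (K : finFieldType) (n : nat) (d : R), 1 <= d ->
  forall A : 'rV[K]_n -> {set 'rV[K]_n},
    2 `^ (- d) * (#|{: 'rV[K]_n}|%:R) ^+ 2 <= (\sum_g #|A g|)%:R ->
    let F := fun x => \sum_g corr (ind R (A g)) (ind R (translate (A g) g)) x in
    let F' := fun x => \sum_g corr (ind R (A g)) (ind R (A g)) x in
    let D := fun x => (#|A x|)%:R : R in
    `|inner (mu_of F) (mu_of D) - 1| <= eps \/
    exists W : {vspace 'rV[K]_n},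
      (n - \dim W)%:R <= C * d ^+ 8 /\
      1 + eps / 32 <= supnorm (convol (mu_of F') (mu_sub R W)).
Proof.
(* Chosen so that [(1 + eps / 8) * (1 - 3 * th)] is at least [1 + eps / 32]. *)
pose th := eps / 48.
have th0 : 0 < th by rewrite divr_gt0.
have th1 : th < 1 by rewrite /th; lra.
pose C1 := 64 * 41 * 48 ^+ 3 / th ^+ 6.
pose C2 := 91 / (eps * th).
exists (C1 * C2 ^+ 4) => K n d d1 A hA F F' D.
have [|hin] := leP `|inner (mu_of F) (mu_of D) - 1| eps; [by left | right].
pose N := #|{: 'rV[K]_n}|%:R : R.
have N0 : 0 < N by rewrite ltr0n; apply/card_gt0P; exists 0.
pose t := 2 `^ (- d) : R.
have t0 : 0 < t by exact: powR_gt0.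
have hA' : t * N ^+ 2 <= \sum_g #|A g|%:R by rewrite -natr_sum.
have hE : t ^+ 2 * N ^+ 2 <= energy R A by apply: energy_ge => //; exact: ltW.
have E0 : 0 < energy R A by apply: lt_le_trans hE; rewrite mulr_gt0 ?exprn_gt0.
(* Large enough for both [1 <= t * 2 ^+ m] and, through [m%:R / 8 <= (9 / 8) ^+ m],
   [1 <= th * (9 / 8) ^+ m]. *)
pose m := (Num.truncn (8 * d / th)).+1.
have dth : d <= d / th by rewrite ler_pdivlMr // ler_piMr; lra.
have m1 : 8 * (d / th) <= m%:R by rewrite mulrA; apply/ltW/truncnS_gt.
have m2 : m%:R <= 9 * (d / th).
  have : (Num.truncn (8 * d / th))%:R <= 8 * d / th by rewrite truncn_le -mulrA; lra.
  by rewrite /m -[(Num.truncn _).+1%:R]natr1 -[8 * d / th]mulrA; lra.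
pose M := (Num.truncn (4 / eps)).+1.
have ie : 1 <= eps^-1 by rewrite invf_ge1 // ltW.
have M1 : 4 / eps <= M%:R by apply/ltW/truncnS_gt.
have M2 : M%:R <= 5 / eps.
  have : (Num.truncn (4 / eps))%:R <= 4 / eps by rewrite truncn_le; lra.
  by rewrite /M -[(Num.truncn _).+1%:R]natr1; lra.
have [||||||B [hB1 hB2]] :=
  @exists_structured_set R K n A eps th t M m heps0 th0 t0 _ _ _ _ E0 hE.
- by rewrite -ler_pdivrMr.
- by rewrite mulrA ler_pM2r ?invr_gt0 // -ler_pdivlMr.
- by apply: pow2_mul_ge1; lra.
- apply: (@le_trans _ _ (th * (m%:R / 8))).
    by rewrite mulrC -ler_pdivrMr // div1r; have : th^-1 <= d / th; [rewrite ler_peMl ?invr_ge0 // ltW | lra].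
  rewrite ler_pM2l //.
  have := @exprn_ge_tangent R m.-1 (9 / 8) 1; rewrite prednK // !expr1n => h.
  have := h ltac:(lra) ltac:(lra); lra.
- have := moment_lower_bound heps0 t0 (isT : (0 < m)%N) hA' hin.
  move=> h; apply: le_trans h _; apply: le_trans (moment_mu_le E0 _) _.
  by under eq_bigr => x _ do rewrite mu_corrE.
- move=> j; have := moment_mu_ge0 E0 j.
  by under eq_bigr => x _ do rewrite mu_corrE.
set P := (M * (2 * m))%N in hB1; set bt := _ / _ in hB1.
pose S := fun x : 'rV[K]_n => 1 + eps / 8 <= diffcount R A x / energy R A.
have tP : 0 < t ^+ (2 * P) by rewrite exprn_gt0.
have B0 : (0 < #|B|)%N.
  rewrite lt0n; apply/eqP => B0; move: hB1.
  by rewrite /bt B0 mul0r expr0n mulr0 leNgt tP.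
have bt0 : 0 <= bt by rewrite divr_ge0.
have hP : d * P%:R <= 90 / (eps * th) * d ^+ 2.
  have -> : 90 / (eps * th) * d ^+ 2 = d * (5 / eps * (2 * (9 * (d / th)))).
    by field; rewrite !gt_eqF.
  rewrite ler_pM2l; last lra.
  rewrite /P !natrM; apply: ler_pM => //.
  by rewrite ler_pM2l.
have q1 : 1 <= (eps * th)^-1 * d ^+ 2.
  rewrite -[leLHS]mulr1; apply: ler_pM => //; last by rewrite exprn_ege1.
  by rewrite invf_ge1 ?mulr_gt0 // mulr_ile1 // ltW.
(* Since [P] is [O(d)], the set [B] has density [exp (- O(d ^ 2))]; the fourth power of [Lam] then
   yields [d ^+ 8]. *)
pose Lam := C2 * d ^+ 2.
have hLam : d * P%:R + 1 <= Lam.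
  by move: hP; rewrite /Lam /C2 -!mulrA; lra.
have Lam1 : 1 <= Lam.
  by apply: le_trans hLam; rewrite lerDr mulr_ge0 //; lra.
(* The extra [1] in [Lam] supplies a factor [1 / 2], which absorbs the [2] in [hB1]. *)
have hbt : expR (- Lam) <= bt.
  rewrite -(@ler_pXn2r _ 2) ?nnegrE ?expR_ge0 //.
  have h1 : expR (- Lam) <= t ^+ P * (1 / 2).
    apply: (@le_trans _ _ (expR (- d) ^+ P * expR (- 1))).
      rewrite -expRM_natl -expRD ler_expR mulrN -opprD lerN2 mulrC; exact: hLam.
    apply: ler_pM; rewrite ?exprn_ge0 ?expR_ge0 //.
      apply: lerXn2r; rewrite ?nnegrE ?expR_ge0 //; first exact: ltW.
      by apply: expRN_le_pow2; lra.
    rewrite expRN div1r lef_pV2 ?posrE ?expR_gt0 //.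
    by apply: le_trans (expR_ge1Dx 1); lra.
  have : expR (- Lam) ^+ 2 <= (t ^+ P * (1 / 2)) ^+ 2.
    apply: lerXn2r => //; rewrite nnegrE ?expR_ge0 //.
    by rewrite mulr_ge0 ?exprn_ge0 ?divr_ge0 // ltW.
  rewrite exprMn -exprM mulnC => h2.
  by have := sqr_ge0 bt; move: h2 hB1 tP; move: (t ^+ _) (bt ^+ 2) (expR _ ^+ 2) => u v w; lra.
have S01 (x : 'rV[K]_n) : 0 <= ((S x)%:R : R) <= 1 by case: (S x); rewrite /= ?ler01 ?lexx.
have [W [hW1 hW2]] := almost_periodicity_exp th0 th1 Lam1 B0 S01 hbt.
exists W; split.
  apply: le_trans hW1 _; rewrite -/C1 /Lam exprMn -exprM mulrA; exact: lexx.
have h0 := @shifted_mean0_ge R K n B S (2 * th) B0 hB2.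
(* A loss of [2 * th] comes from the bad differences of [B] and a loss of [th] from almost
   periodicity. *)
have hW3 : 1 - 3 * th <= mean [set y | y \in W] (shifted_mean B (fun x => (S x)%:R)).
  move: hW2 h0; rewrite ler_norml => /andP[_].
  by move: (shifted_mean _ _ 0) (mean _ _) => u v; lra.
have [x hx] := exists_dense_coset B0 hW3.
have W0 : (0 < #|[set y : 'rV[K]_n | y \in W]|)%N.
  by apply/card_gt0P; exists 0; rewrite inE mem0v.
apply: le_trans (le_supnorm _ x); apply: le_trans (ler_norm _).
rewrite convol_mu_subE.
apply: (@le_trans _ _ ((1 + eps / 8) * (1 - 3 * th))); first by rewrite /th; nra.
apply: (@le_trans _ _ ((1 + eps / 8) * mean [set y | y \in W] (fun w => (S (x + w))%:R))).
  by rewrite ler_pM2l //; lra.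
(* Pointwise, [mu_F'] dominates [1 + eps / 8] times the indicator of [S], being non-negative off
   [S]. *)
rewrite /mean mulrA mulr_sumr -/(mean _ _).
apply: ler_mean => // w _; rewrite mu_corrE.
case: (boolP (S (x + w))) => [h|_]; first by rewrite mulr1.
by rewrite mulr0 divr_ge0 ?diffcount_ge0 // ltW.
Qed.
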